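(* Let $(\mathcal T,\otimes,\iota,\varepsilon)$ be a symmetric tensor $C^*$-category. Then $C(X^\iota)$ coincides with $(\iota,\iota)$. If $\mathcal T$ is T-specially directed, then $\mathcal T$ is a continuous bundle of symmetric tensor $C^*$-categories over $X^\iota$.
   Context: A unital $C^*$-category $\mathcal T$ is a category with identity arrows $1_\rho$, whose arrow sets $(\rho,\sigma)$ are complex Banach spaces, with bilinear composition satisfying $\|t'\circ t\|\le\|t'\|\|t\|$ and an antilinear isometric involutive contravariant functor $*$, identical on objects, with $\|t^*\circ t\|=\|t\|^2$. A tensor $C^*$-category $(\mathcal T,\otimes,\iota)$ is a unital $C^*$-category with an associative, unital $C^*$-bifunctor $\otimes$ and an identity object $\iota$ with $\iota\otimes\rho=\rho\otimes\iota=\rho$, $t\otimes1_\iota=1_\iota\otimes t=t$. Write $\rho\sigma:=\rho\otimes\sigma$, $\rho^r$ for tensor powers, $\rho^0=\iota$. It is symmetric if there are unitaries $\varepsilon(\rho,\sigma)\in(\rho\sigma,\sigma\rho)$ with $\varepsilon(\sigma,\sigma')\circ(t\otimes t')=(t'\otimes t)\circ\varepsilon(\rho,\rho')$ for $t\in(\rho,\sigma)$, $t'\in(\rho',\sigma')$, and the usual relations $\varepsilon(\sigma,\rho)\circ\varepsilon(\rho,\sigma)=1_{\rho\sigma}$, $\varepsilon(\iota,\rho)=\varepsilon(\rho,\iota)=1_\rho$, $\varepsilon(\rho\sigma,\tau)=(\varepsilon(\rho,\tau)\otimes1_\sigma)\circ(1_\rho\otimes\varepsilon(\sigma,\tau))$.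 $X^\iota$ is the compact Hausdorff spectrum of the commutative unital $C^*$-algebra $\{f\in(\iota,\iota):f\otimes1_\rho=1_\rho\otimes f\text{ for every object }\rho\}$, which is identified with $C(X^\iota)$. For $f\in C(X^\iota)$ and an arrow $t$ write $ft:=f\otimes t=t\otimes f$. Fibres: for $x\in X^\iota$, $\mathcal T_x$ has the same objects as $\mathcal T$ and arrows $(\rho,\sigma)_x:=(\rho,\sigma)/[C_x(X^\iota)(\rho,\sigma)]$, $C_x(X^\iota)$ being the functions vanishing at $x$; $\pi_x:\mathcal T\to\mathcal T_x$ is the quotient functor, and $\mathcal T_x$ is a symmetric tensor $C^*$-category with $\pi_x(t)\otimes_x\pi_x(t'):=\pi_x(t\otimes t')$ and symmetry $\pi_x(\varepsilon(\rho,\sigma))$. $\mathcal T$ is a continuous bundle of (symmetric) tensor $C^*$-categories over $X^\iota$ if $x\mapsto\|\pi_x(t)\|$ is continuous on $X^\iota$ for every arrow $t$ of $\mathcal T$. The symmetry gives unitary representations $\varepsilon_\rho:\mathbb P_r\to(\rho^r,\rho^r)$ of the permutation group of $r$ objects (the transposition of $i,i+1$ goes to $1_{\rho^{i-1}}\otimes\varepsilon(\rho,\rho)\otimes1_{\rho^{r-i-1}}$), and $P_{\rho,\varepsilon,r}:=\frac1{r!}\sum_{p}\mathrm{sign}(p)\,\varepsilon_\rho(p)$. A twisted special object is a triple $(\rho,d,\mathcal V)$ with $\rho$ an object, $d\in\mathbb N$ ($d\ge1$), and $\mathcal V\subseteq(\iota,\rho^d)$ a closed subspace such that for all $V,V'\in\mathcal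 V$, $f\in(\iota,\iota)$: (1) $f\otimes V=V\otimes f\in\mathcal V$; (2) $(V^*\otimes1_\rho)\circ(1_\rho\otimes V')=(-1)^{d-1}d^{-1}(V^*\circ V')\otimes1_\rho$; (3) $\mathrm{span}\{V'\circ V^*:V,V'\in\mathcal V\}=(\iota,\iota)\otimes P_{\rho,\varepsilon,d}$. $\mathcal T$ is T-specially directed if every object $\rho'$ is dominated by a twisted special object $\rho$, i.e. there exist orthogonal partial isometries $S_i\in(\rho',\rho^{n_i})$, $i=1,\dots,m$, with $1_{\rho'}=\sum_iS_i^*\circ S_i$.
   Formalization: A twisted special object is also required to satisfy: f⊗P_{ρ,ε,d}=0 implies f=0 for f in (ι,ι). Without this, P_{ρ,ε,d}=0 with 𝒱={0} satisfies (1)–(3) vacuously and the continuity claim is false. *)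

(* Defs.v *)
From HB Require Import structures.
From mathcomp Require Import all_boot all_order all_algebra all_fingroup.
From mathcomp.real_closed Require Import complex.
From mathcomp Require Import all_classical all_reals topology normedtype.

Set Implicit Arguments.
Unset Strict Implicit.
Unset Printing Implicit Defensive.

Import Order.TTheory GRing.Theory Num.Theory numFieldNormedType.Exports.

Local Open Scope classical_set_scope.
Local Open Scope ring_scope.
Local Open Scope complex_scope.

(* No positivity of [t^* \o t] in the C*-algebra [arrow ρ ρ] is assumed: the C*-identity is
   the only link between norm and involution. *)
Record cstar_category (R : realType) := CStarCategory {
  ob :> Type;
  arrow : ob -> ob -> completeNormedModType R[i];
  idn : forall ρ, arrow ρ ρ;
  compose : forall ρ σ τ, arrow σ τ -> arrow ρ σ -> arrow ρ τ;
  star : forall ρ σ, arrow ρ σ -> arrow σ ρ;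
  compA : forall ρ σ τ υ (t : arrow τ υ) (s : arrow σ τ) (r : arrow ρ σ),
    compose t (compose s r) = compose (compose t s) r;
  compid : forall ρ σ (t : arrow ρ σ), compose t (idn ρ) = t;
  idcomp : forall ρ σ (t : arrow ρ σ), compose (idn σ) t = t;
  comp_linear_l : forall ρ σ τ (s : arrow ρ σ),
    linear (fun t : arrow σ τ => compose t s);
  comp_linear_r : forall ρ σ τ (t : arrow σ τ),
    linear (fun s : arrow ρ σ => compose t s);
  norm_comp : forall ρ σ τ (t : arrow σ τ) (s : arrow ρ σ),
    `|compose t s| <= `|t| * `|s|;
  star_id : forall ρ, star (idn ρ) = idn ρ;
  star_compose : forall ρ σ τ (t : arrow σ τ) (s : arrow ρ σ),
    star (compose t s) = compose (star s) (star t);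
  star_antilinear : forall ρ σ (a : R[i]) (t s : arrow ρ σ),
    star (a *: t + s) = (a^*)%C *: star t + star s;
  starK : forall ρ σ (t : arrow ρ σ), star (star t) = t;
  norm_star : forall ρ σ (t : arrow ρ σ), `|star t| = `|t|;
  cstar_identity : forall ρ σ (t : arrow ρ σ),
    `|compose (star t) t| = `|t| ^+ 2
}.

Arguments arrow {R c} ρ σ : rename.
Arguments idn {R c} ρ : rename.
Arguments compose {R c ρ σ τ} t s : rename.
Arguments star {R c ρ σ} t : rename.

Declare Scope cstar_scope.
Delimit Scope cstar_scope with cstar.
Local Open Scope cstar_scope.
Reserved Notation "t ⊗ s" (at level 39, left associativity).
Reserved Notation "ρ ⊙ σ" (at level 39, left associativity).
Reserved Notation "t ∘ s" (at level 40, left associativity).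
Reserved Notation "t ^†" (at level 1, format "t ^†").
Notation "t ∘ s" := (compose t s) : cstar_scope.
Notation "t ^†" := (star t) : cstar_scope.

(* Tensor products are strict: ρ(στ) and (ρσ)τ are equal objects, but not convertible, so
   that arrows are transported along equalities of their source and target. *)
Definition hcast (R : realType) (T : cstar_category R) (ρ ρ' σ σ' : T)
    (e : ρ = ρ') (e' : σ = σ') (t : arrow ρ σ) : arrow ρ' σ' :=
  ecast z (arrow z σ') e (ecast z (arrow ρ z) e' t).

Record tensor_cstar_category (R : realType) := TensorCStarCategory {
  tcat :> cstar_category R;
  tob : tcat -> tcat -> tcat;
  tunit : tcat;
  tens : forall ρ σ ρ' σ' : tcat,
    arrow ρ σ -> arrow ρ' σ' -> arrow (tob ρ ρ') (tob σ σ');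
  tobA : forall ρ σ τ, tob ρ (tob σ τ) = tob (tob ρ σ) τ;
  tob1l : forall ρ, tob tunit ρ = ρ;
  tob1r : forall ρ, tob ρ tunit = ρ;
  tens_id : forall ρ σ, tens (idn ρ) (idn σ) = idn (tob ρ σ);
  tens_comp : forall ρ σ τ ρ' σ' τ' (t : arrow σ τ) (s : arrow ρ σ)
      (t' : arrow σ' τ') (s' : arrow ρ' σ'),
    tens (t ∘ s) (t' ∘ s') = tens t t' ∘ tens s s';
  tens_linear_l : forall ρ σ ρ' σ' (t' : arrow ρ' σ'),
    linear (fun t : arrow ρ σ => tens t t');
  tens_linear_r : forall ρ σ ρ' σ' (t : arrow ρ σ),
    linear (fun t' : arrow ρ' σ' => tens t t');
  tens_star : forall ρ σ ρ' σ' (t : arrow ρ σ) (t' : arrow ρ' σ'),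
    (tens t t')^† = tens t^† t'^†;
  tensA : forall ρ σ ρ' σ' ρ'' σ''
      (t : arrow ρ σ) (t' : arrow ρ' σ') (t'' : arrow ρ'' σ''),
    hcast (tobA _ _ _) (tobA _ _ _) (tens t (tens t' t''))
      = tens (tens t t') t'';
  tens1l : forall ρ σ (t : arrow ρ σ),
    hcast (tob1l _) (tob1l _) (tens (idn tunit) t) = t;
  tens1r : forall ρ σ (t : arrow ρ σ),
    hcast (tob1r _) (tob1r _) (tens t (idn tunit)) = t
}.

Arguments tob {R _} _ _.
Arguments tunit {R _}.
Arguments tens {R _} {ρ σ ρ' σ'} _ _.
Notation "ρ ⊙ σ" := (tob ρ σ) : cstar_scope.
Notation "t ⊗ s" := (tens t s) : cstar_scope.
Notation ι := tunit.

Record symmetric_tensor_cstar_category (R : realType) :=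
  SymmetricTensorCStarCategory {
  scat :> tensor_cstar_category R;
  symmetry : forall ρ σ : scat, arrow (ρ ⊙ σ) (σ ⊙ ρ);
  sym_isometry : forall ρ σ, (symmetry ρ σ)^† ∘ symmetry ρ σ = idn (ρ ⊙ σ);
  sym_coisometry : forall ρ σ, symmetry ρ σ ∘ (symmetry ρ σ)^† = idn (σ ⊙ ρ);
  sym_natural : forall (ρ σ ρ' σ' : scat) (t : arrow ρ σ) (t' : arrow ρ' σ'),
    symmetry σ σ' ∘ (t ⊗ t') = (t' ⊗ t) ∘ symmetry ρ ρ';
  symK : forall ρ σ, symmetry σ ρ ∘ symmetry ρ σ = idn (ρ ⊙ σ);
  sym1l : forall ρ, hcast (tob1l ρ) (tob1r ρ) (symmetry ι ρ) = idn ρ;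
  sym1r : forall ρ, hcast (tob1r ρ) (tob1l ρ) (symmetry ρ ι) = idn ρ;
  sym_hexagon : forall ρ σ τ,
    symmetry (ρ ⊙ σ) τ =
      hcast (erefl _) (esym (tobA τ ρ σ)) (symmetry ρ τ ⊗ idn σ)
        ∘ hcast (tobA ρ σ τ) (tobA ρ τ σ) (idn ρ ⊗ symmetry σ τ)
}.

Section Powers.
Context {R : realType} {T : tensor_cstar_category R}.
Implicit Types ρ : T.

Fixpoint tpow ρ (n : nat) : T := if n is m.+1 then ρ ⊙ tpow ρ m else ι.

Lemma tpowD ρ m n : tpow ρ m ⊙ tpow ρ n = tpow ρ (m + n).
Proof. by elim: m => [|m IH] /=; rewrite ?tob1l // -tobA IH. Qed.

Lemma tpow1 ρ : tpow ρ 1 = ρ. Proof. exact: tob1r. Qed.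

Lemma tpowSr ρ n : tpow ρ n ⊙ ρ = ρ ⊙ tpow ρ n.
Proof. by rewrite -{2}(tpow1 ρ) tpowD addn1. Qed.

End Powers.

Notation "ρ ^⊗ n" := (tpow ρ n) (at level 30, format "ρ  ^⊗  n") : cstar_scope.

Section AdjacentTranspositions.
Variable r : nat.

Lemma adj_subproof (i : 'I_r.-1) : (i.+1 < r)%N.
Proof. by case: r i => [|n] i /=; [case: i | rewrite ltnS ltn_ord]. Qed.

Definition adj_transposition (i : 'I_r.-1) : 'S_r :=
  tperm (Ordinal (ltnW (adj_subproof i))) (Ordinal (adj_subproof i)).

(* The composite s_1 \o s_2 \o ... of the functions named by w; the product of 'S_r composes
   in the opposite order. *)
Fixpoint word_perm (w : seq 'I_r.-1) : 'S_r :=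
  if w is i :: w' then (word_perm w' * adj_transposition i)%g else 1%g.

Lemma word_perm_cat w1 w2 :
  word_perm (w1 ++ w2) = (word_perm w2 * word_perm w1)%g.
Proof.
by elim: w1 => [|i w1 IH] /=; rewrite ?mulg1 // IH mulgA.
Qed.

Lemma word_perm_surj (p : 'S_r) : exists w, word_perm w == p.
Proof.
have ht : forall (k : nat) (i j : 'I_r), j = (i + k)%N :> nat ->
    exists w, word_perm w = tperm i j.
  elim=> [|k IH] i j; rewrite ?addn0 ?addnS => ij.
    by exists [::]; rewrite (val_inj ij) tperm1.
  have ikr : (i + k < r)%N by rewrite (leq_trans _ (ltn_ord j)) // ij.
  have ikr1 : (i + k < r.-1)%N.
    by rewrite -ltnS (leq_trans _ (leqSpred r)) // -ij ltn_ord.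
  pose m := Ordinal ikr; pose a := Ordinal ikr1.
  have [w wE] := IH i m erefl.
  have aE : adj_transposition a = tperm m j.
    by congr tperm; apply: val_inj.
  case: k IH ij ikr ikr1 @m @a w wE aE => [|k] IH ij ikr ikr1 m a w wE aE.
    exists [:: a]; rewrite /= mul1g aE; congr tperm.
    by apply: val_inj; rewrite /= addn0.
  exists ([:: a] ++ w ++ [:: a]); rewrite !word_perm_cat /= !mul1g wE aE.
  rewrite -{1}[tperm m j]tpermV -mulgA -/(_ ^ _)%g tpermJ tpermL tpermD //.
  - by rewrite -val_eqE /= eqn_leq negb_and -!ltnNge addnS ltnS leq_addr.
  - by rewrite -val_eqE /= ij eqn_leq negb_and -!ltnNge ltnS leq_addr.
have ht' (i j : 'I_r) : exists w, word_perm w = tperm i j.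
  have [ij|/ltnW ji] := leqP i j; first by apply: (ht (j - i)%N); rewrite subnKC.
  by rewrite tpermC; apply: (ht (i - j)%N); rewrite subnKC.
have [ts -> _] := prod_tpermP p.
elim: ts => [|t ts [w /eqP wE]]; first by exists [::]; rewrite big_nil.
have [v vE] := ht' t.1 t.2.
by exists (w ++ v); rewrite word_perm_cat big_cons wE vE.
Qed.

End AdjacentTranspositions.

Section Antisymmetrizer.
Context {R : realType} {T : symmetric_tensor_cstar_category R}.
Variables (ρ : T) (r : nat).

Lemma adj_generator_subproof (i : 'I_r.-1) :
  ρ ^⊗ i ⊙ (ρ ⊙ ρ ⊙ ρ ^⊗ (r - i.+2)) = ρ ^⊗ r.
Proof.
rewrite -tobA -[ρ ⊙ (ρ ⊙ _)]/(ρ ^⊗ (r - i.+2).+2) tpowD.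
by rewrite -!addSnnS subnKC // adj_subproof.
Qed.

Definition adj_generator (i : 'I_r.-1) : arrow (ρ ^⊗ r) (ρ ^⊗ r) :=
  hcast (adj_generator_subproof i) (adj_generator_subproof i)
    (idn (ρ ^⊗ i) ⊗ (symmetry ρ ρ ⊗ idn (ρ ^⊗ (r - i.+2)))).

Fixpoint word_arrow (w : seq 'I_r.-1) : arrow (ρ ^⊗ r) (ρ ^⊗ r) :=
  if w is i :: w' then adj_generator i ∘ word_arrow w' else idn _.

(* The value at p of the representation sending adjacent transpositions to the adjacent
   generators, read off a word for p; by the braid relations it does not depend on the word. *)
Definition perm_arrow (p : 'S_r) : arrow (ρ ^⊗ r) (ρ ^⊗ r) :=
  word_arrow (xchoose (word_perm_surj p)).

Definition antisymmetrizer : arrow (ρ ^⊗ r) (ρ ^⊗ r) :=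
  (r`!%:R)^-1 *: \sum_(p : 'S_r) ((-1) ^+ odd_perm p *: perm_arrow p).

End Antisymmetrizer.

Section Subspaces.
Context {R : realType} {V : completeNormedModType R[i]}.

Definition is_subspace (A : set V) : Prop :=
  A 0 /\ forall (a : R[i]) (u v : V), A u -> A v -> A (a *: u + v).

Definition lspan (A : set V) : set V := smallest is_subspace A.

Definition closed_lspan (A : set V) : set V :=
  smallest (fun B => is_subspace B /\ closed B) A.

Lemma closed_lspan_subspace (A : set V) : is_subspace (closed_lspan A).
Proof.
split=> [B [[[]]]//|a u v Au Av B BA]; have [[[_ BD] _] _] := BA.
by apply: BD; [exact: Au | exact: Av].
Qed.

End Subspaces.

Section UnitAction.
Context {R : realType} {T : tensor_cstar_category R}.
Implicit Types ρ σ : T.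

Definition lact ρ σ (f : arrow ι ι) (t : arrow ρ σ) : arrow ρ σ :=
  hcast (tob1l ρ) (tob1l σ) (f ⊗ t).

Definition ract ρ σ (t : arrow ρ σ) (f : arrow ι ι) : arrow ρ σ :=
  hcast (tob1r ρ) (tob1r σ) (t ⊗ f).

Definition central (f : arrow (ι : T) ι) : Prop :=
  forall ρ, lact f (idn ρ) = ract (idn ρ) f.

End UnitAction.

Section SpeciallyDirected.
Context {R : realType} {T : symmetric_tensor_cstar_category R}.

(* In [ts_span], (ι,ι) ⊗ P stands for a copy of (ι,ι): [ts_faithful] says that f -> f ⊗ P is
   injective. Without it, an object with P = 0 would be twisted special of dimension d through
   the zero subspace, and the domination property below would carry no information on it. *)
Record twisted_special (ρ : T) (d : nat) (V : set (arrow ι (ρ ^⊗ d))) : Prop :=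
  TwistedSpecial {
  ts_dim : (0 < d)%N;
  ts_subspace : is_subspace V;
  ts_closed : closed V;
  ts_bimodule : forall v (f : arrow ι ι), V v ->
    lact f v = ract v f /\ V (lact f v);
  ts_conjugate : forall v v', V v -> V v' ->
    hcast (tob1r ρ) (tob1l ρ)
        ((v^† ⊗ idn ρ) ∘ hcast (erefl _) (esym (tpowSr ρ d)) (idn ρ ⊗ v'))
      = lact (((-1) ^+ d.-1 * d%:R^-1) *: (v^† ∘ v')) (idn ρ);
  ts_span : lspan [set w | exists v v', [/\ V v, V v' & w = v' ∘ v^†]]
      = [set lact f (antisymmetrizer ρ d) | f in [set: arrow ι ι]];
  ts_faithful : forall f : arrow ι ι,
    lact f (antisymmetrizer ρ d) = 0 -> f = 0
}.

Definition partial_isometry (ρ σ : T) (t : arrow ρ σ) : Prop :=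
  t ∘ t^† ∘ t = t.

(* Since the targets differ, orthogonality of the S_i is that of their initial projections. *)
Definition dominated (ρ' ρ : T) : Prop :=
  exists (m : nat) (n : 'I_m -> nat) (S : forall i, arrow ρ' (ρ ^⊗ n i)),
    [/\ forall i, partial_isometry (S i),
        forall i j, i != j -> S i ∘ (S j)^† = 0
      & idn ρ' = \sum_i (S i)^† ∘ S i].

End SpeciallyDirected.

Definition T_specially_directed (R : realType)
    (T : symmetric_tensor_cstar_category R) : Prop :=
  forall ρ' : T, exists (ρ : T) (d : nat) (V : set (arrow ι (ρ ^⊗ d))),
    twisted_special V /\ dominated ρ' ρ.

Section HcastTheory.
Context {R : realType} {T : cstar_category R}.
Implicit Types ρ σ τ : T.

Lemma hcast_linear ρ ρ' σ σ' (e : ρ = ρ') (e' : σ = σ') :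
  linear (hcast e e' : arrow ρ σ -> arrow ρ' σ').
Proof. by case: _ / e; case: _ / e'. Qed.

Lemma hcast_comp ρ ρ' σ σ' τ τ' (e : ρ = ρ') (e' : σ = σ') (e'' : τ = τ')
    (t : arrow σ τ) (s : arrow ρ σ) :
  hcast e e'' (t ∘ s) = hcast e' e'' t ∘ hcast e e' s.
Proof. by case: _ / e; case: _ / e' t s; case: _ / e'' => t s. Qed.

Lemma hcast_id ρ ρ' (e : ρ = ρ') : hcast e e (idn ρ) = idn ρ'.
Proof. by case: _ / e. Qed.

End HcastTheory.

Section Spectrum.
Context {R : realType} {T : tensor_cstar_category R}.

Definition centre_pred : {pred arrow (ι : T) ι} := fun f => `[< central f >].

Lemma lact_linear (ρ σ : T) (t : arrow ρ σ) : linear (fun f : arrow (ι : T) ι => lact f t).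
Proof. by move=> a f g; rewrite /lact tens_linear_l hcast_linear. Qed.

Lemma ract_linear (ρ σ : T) (t : arrow ρ σ) : linear (fun f : arrow (ι : T) ι => ract t f).
Proof. by move=> a f g; rewrite /ract tens_linear_r hcast_linear. Qed.

Lemma centre_submod_closed : submod_closed centre_pred.
Proof.
split=> [|a f g /asboolP fZ /asboolP gZ]; apply/asboolP => ρ.
  have l0 := lact_linear (idn ρ) (-1) 0 0; have r0 := ract_linear (idn ρ) (-1) 0 0.
  by move: l0 r0; rewrite scaler0 addr0 !scaleN1r !addNr => -> ->.
by rewrite lact_linear ract_linear fZ gZ.
Qed.

HB.instance Definition _ :=
  GRing.isSubmodClosed.Build R[i] (arrow (ι : T) ι) centre_pred centre_submod_closed.

(* The commutative C*-algebra denoted C(X^ι). *)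
Record centre := Centre { centre_val :> arrow (ι : T) ι; _ : centre_val \in centre_pred }.

HB.instance Definition _ := [isSub for centre_val].
HB.instance Definition _ := [Choice of centre by <:].
HB.instance Definition _ := [SubChoice_isSubLmodule of centre by <:].

Lemma centre_id_subproof : idn ι \in centre_pred.
Proof. by apply/asboolP => ρ; rewrite /lact /ract !tens_id !hcast_id. Qed.

Definition centre_id := Centre centre_id_subproof.

Lemma centre_comp_subproof (f g : centre) :
  (f : arrow ι ι) ∘ (g : arrow ι ι) \in centre_pred.
Proof.
case: f g => f /= /asboolP fZ [g /= /asboolP gZ]; apply/asboolP => ρ.
rewrite /lact /ract -{1 2}(compid (idn ρ)) !tens_comp.
rewrite (hcast_comp _ (tob1l ρ)) (hcast_comp _ (tob1r ρ)).
by congr (_ ∘ _); [exact: fZ | exact: gZ].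
Qed.

Definition centre_comp (f g : centre) : centre := Centre (centre_comp_subproof f g).

Record character := Character {
  character_fun :> {linear centre -> R[i]^o};
  character1 : character_fun centre_id = 1;
  characterM : forall f g : centre,
    character_fun (centre_comp f g) = (character_fun f : R[i]) * character_fun g
}.

HB.instance Definition _ := gen_eqMixin character.
HB.instance Definition _ := gen_choiceMixin character.

End Spectrum.

Arguments centre {R} T.
Arguments character {R} T.

(* The Gelfand spectrum X^ι: characters with the topology of pointwise convergence. *)
Definition spectrum (R : realType) (T : tensor_cstar_category R) : topologicalType :=
  initial_topology (fun x : character T => (x : centre T -> R[i]^o) : {ptws centre T -> R[i]^o}).

Section Fibres.
Context {R : realType} {T : tensor_cstar_category R}.
Variables (x : spectrum T) (ρ σ : T).

(* Under Gelfand duality the value at x of f in C(X^ι) is [x f]. *)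
Definition vanishing_part : set (arrow ρ σ) :=
  closed_lspan [set lact f t | f in [set f : centre T | (x : character T) f = 0] & t in setT].

Definition vanishing_pred : {pred arrow ρ σ} := fun t => `[< vanishing_part t >].

Lemma vanishing_zmod_closed : zmod_closed vanishing_pred.
Proof.
have [A0 AD] : is_subspace vanishing_part by exact: closed_lspan_subspace.
split=> [|t s /asboolP At /asboolP As]; apply/asboolP => //.
by rewrite addrC -scaleN1r; exact: AD.
Qed.

HB.instance Definition _ :=
  GRing.isZmodClosed.Build (arrow ρ σ) vanishing_pred vanishing_zmod_closed.

Definition fibre : Type := Quotient.quot vanishing_pred.

Definition fibre_proj (t : arrow ρ σ) : fibre := \pi_(Quotient.quot vanishing_pred)%qT t.

Definition fibre_norm (a : fibre) : R :=
  inf [set complex.Re `|t| | t in [set t | fibre_proj t = a]].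

End Fibres.

Definition continuous_bundle (R : realType) (T : tensor_cstar_category R) : Prop :=
  forall (ρ σ : T) (t : arrow ρ σ),
    continuous (fun x : spectrum T => fibre_norm (fibre_proj x t)).

(* Main.v *)
(* Naturality of the symmetry at f in (ι,ι), together with ε(ι,ρ) = 1, says that f is central.

   For continuity, let N_x(t) be the infimum of |g t| over the g in the unit ball of (ι,ι) with
   g(x) = 1. Approximate units made of powers of 1 - a^2 show that N_x(t) is the quotient norm
   at x, and it inherits the C*-identity N_x(t^* t) = N_x(t)^2. On (ι,τ) this already gives
   N_x(t)^2 = |(t^* t)(x)|, which is continuous. If ρ is twisted special with dimension d, then P
   is idempotent (by the Coxeter presentation of the permutation group), so P = Σ V'_l V_l^* gives
   (k - 1) P = 0 for some k in the span of the V^* V', whence k = 1; by (2) ρ satisfies a zig-zag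
   equation Σ (V^* ⊗ 1)(1 ⊗ V') = 1 up to a nonzero scalar. Thus arrows out of ρκ embed into
   finitely many arrows out of κ, with norm estimates uniform in x, and by induction N_x on
   (ρ^n,τ) is bounded on both sides by constant multiples of a function continuous in x. By
   domination the same holds on every (ρ',τ). Applying these bounds to (t^* t)^(2^k) and taking
   roots, the constants tend to 1, so that N_x(t) is a uniform limit of continuous functions. *)
From mathcomp Require Import all_boot all_order all_algebra all_fingroup zify ring lra.
From mathcomp.real_closed Require Import complex.
From mathcomp Require Import all_classical all_reals topology normedtype sequences realfun.
Require Import Defs.

Set Implicit Arguments.
Unset Strict Implicit.
Unset Printing Implicit Defensive.

Import Order.TTheory GRing.Theory Num.Theory numFieldNormedType.Exports.

Local Open Scope classical_set_scope.
Local Open Scope ring_scope.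
Local Open Scope complex_scope.
Local Open Scope cstar_scope.

Arguments hcast : simpl never.

(** * Real-valued norms and fixed points *)

Section RealNorm.
Context {R : realType}.

Definition cabs (z : R[i]) : R := complex.Re `|z|.

Lemma normC_cabs (z : R[i]) : `|z| = (cabs z)%:C.
Proof. by rewrite /cabs RRe_real // ger0_real. Qed.

Lemma cabsM (z w : R[i]) : cabs (z * w) = cabs z * cabs w.
Proof. by apply: (@complexI R); rewrite rmorphM /= -!normC_cabs normrM. Qed.

Lemma cabs_real (r : R) : cabs r%:C = `|r|.
Proof. by rewrite /cabs normc_def /= expr0n /= addr0 sqrtr_sqr. Qed.

Lemma cabs1 : cabs 1 = 1. Proof. by rewrite (cabs_real 1) normr1. Qed.
Lemma cabs0 : cabs 0 = 0. Proof. by rewrite (cabs_real 0) normr0. Qed.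

(* Monomorphic, so that [imag *: t] is always elaborated with the same module structure. *)
Definition imag : R[i] := 'i%C.

Lemma sqr_imag : imag ^+ 2 = -1. Proof. exact: sqr_i. Qed.

Lemma cabs_ge0 (z : R[i]) : 0 <= cabs z.
Proof. by have := normr_ge0 z; rewrite normC_cabs lecR. Qed.
Lemma sqr_cabs (z : R[i]) : cabs z ^+ 2 = complex.Re z ^+ 2 + complex.Im z ^+ 2.
Proof. by rewrite /cabs normc_def sqr_sqrtr // addr_ge0 ?sqr_ge0. Qed.

Context {V : normedModType R[i]}.
Implicit Types u v : V.

Definition nrm v : R := complex.Re `|v|.

Lemma norm_nrm v : `|v| = (nrm v)%:C.
Proof. by rewrite /nrm RRe_real // ger0_real. Qed.
Lemma nrm_ge0 v : 0 <= nrm v.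
Proof. by have := normr_ge0 v; rewrite norm_nrm lecR. Qed.
Lemma nrm0 : nrm 0 = 0. Proof. by rewrite /nrm normr0. Qed.
Lemma nrm_eq0 v : nrm v = 0 -> v = 0.
Proof. by move=> v0; apply/normr0_eq0; rewrite norm_nrm v0. Qed.
Lemma nrmN v : nrm (- v) = nrm v. Proof. by rewrite /nrm normrN. Qed.
Lemma nrmBC u v : nrm (u - v) = nrm (v - u). Proof. by rewrite -nrmN opprB. Qed.
Lemma nrmD u v : nrm (u + v) <= nrm u + nrm v.
Proof. by have := ler_normD u v; rewrite !norm_nrm -rmorphD /= lecR. Qed.
Lemma nrmB u v : nrm (u - v) <= nrm u + nrm v.
Proof. by rewrite (le_trans (nrmD _ _)) // nrmN. Qed.
Lemma nrmZ (a : R[i]) v : nrm (a *: v) = cabs a * nrm v.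
Proof.
by apply: (@complexI R); rewrite rmorphM /= -norm_nrm normrZ norm_nrm normC_cabs.
Qed.
Lemma nrm_sum (I : Type) (r : seq I) (P : pred I) (F : I -> V) :
  nrm (\sum_(i <- r | P i) F i) <= \sum_(i <- r | P i) nrm (F i).
Proof.
elim/big_ind2 : _ => //; first by rewrite nrm0.
by move=> a b c d ab cd; rewrite (le_trans (nrmD _ _)) // lerD.
Qed.

Lemma scale_halfD v : (2^-1 : R)%:C *: v + (2^-1 : R)%:C *: v = v.
Proof.
rewrite -scalerDl -rmorphD /=.
by rewrite (_ : 2^-1 + 2^-1 = 1 :> R) ?scale1r //; field.
Qed.

Lemma nrm_lim0 v : (forall e : R, 0 < e -> nrm v < e) -> v = 0.
Proof.
move=> v0; apply/nrm_eq0/eqP; rewrite eq_le nrm_ge0 andbT leNgt.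
by apply/negP => /v0; rewrite ltxx.
Qed.

End RealNorm.

(** * The Banach fixed point theorem *)

Section FixedPoint.
Context {R : realType} {V : completeNormedModType R[i]}.

Definition limit_closed (U : set V) :=
  forall l, (forall e : R, 0 < e -> exists2 u, U u & nrm (u - l) < e) -> U l.

Lemma geometric_small (q e : R) : 0 <= q -> q < 1 -> 0 < e -> exists n, q ^+ n < e.
Proof.
move=> q0 q1 e0.
have := @cvg_geometric R 1 q; rewrite ger0_norm // => /(_ q1).
move=> /cvgrPdist_lt /(_ _ e0) [N _ /(_ N (leqnn _))].
by rewrite /geometric /= mul1r sub0r normrN ger0_norm ?exprn_ge0 //; exists N.
Qed.

Lemma geometric_cauchy_cvg (u : nat -> V) (K q : R) : 0 <= q -> q < 1 ->
  (forall n, nrm (u n.+1 - u n) <= K * q ^+ n) ->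
  exists l, forall n, nrm (u n - l) <= K / (1 - q) * q ^+ n.
Proof.
move=> q0 q1 du.
have K0 : 0 <= K by have := du 0%N; rewrite expr0 mulr1; apply: le_trans; rewrite nrm_ge0.
have q'0 : 0 < 1 - q by rewrite subr_gt0.
(* The bound is the partial geometric sum rather than its limit, so that the induction on [m]
   closes. *)
have dist n m : nrm (u (n + m)%N - u n) <= K / (1 - q) * q ^+ n * (1 - q ^+ m).
  elim: m => [|m IH]; first by rewrite addn0 subrr nrm0 expr0 subrr mulr0.
  rewrite addnS -(subrKA (u (n + m)%N)) (le_trans (nrmD _ _)) //.
  rewrite (le_trans (lerD (du _) IH)) // exprD exprS le_eqVlt; apply/orP; left.
  by apply/eqP; field; rewrite gt_eqF.
have dist' n m : nrm (u (n + m)%N - u n) <= K / (1 - q) * q ^+ n.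
  rewrite (le_trans (dist n m)) // -[leRHS]mulr1 ler_wpM2l //.
    by rewrite mulr_ge0 ?exprn_ge0 // divr_ge0 // ltW.
  by rewrite lerBlDr lerDl exprn_ge0.
have ucvg : cvg (u @ \oo).
  apply: cauchy_cvg; apply: cauchy_exP => -[e e'] /=; rewrite ltcE /= => /andP[/eqP -> e0].
  have [n qn] : exists n, q ^+ n < e / (K / (1 - q) + 1).
    apply: geometric_small => //.
    by rewrite divr_gt0 // ltr_wpDl // divr_ge0 // ltW.
  exists (u n), n => // m /= nm.
  rewrite -ball_normE /= distrC norm_nrm ltcR -(subnKC nm) (le_lt_trans (dist' _ _)) //.
  move: qn; rewrite ltr_pdivlMr; last by rewrite ltr_wpDl // divr_ge0 // ltW.
  by apply: le_lt_trans; rewrite mulrC ler_wpM2l ?exprn_ge0 // lerDl.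
exists (lim (u @ \oo)) => n.
rewrite leNgt; apply/negP; set l := lim _; set b := K / _ * _; rewrite -subr_gt0 => lt_l.
move/cvgrPdist_lt : (ucvg) => /(_ (nrm (u n - l) - b)%:C); rewrite ltcR.
move=> /(_ lt_l) [N _ /(_ (n + N)%N)] /= /(_ (leq_addl _ _)).
rewrite -/l norm_nrm ltcR ltNge => /negP; apply.
rewrite lerBlDr -(subrKA (u (n + N)%N)) addrC (le_trans (nrmD _ _)) //.
by rewrite lerD // nrmBC //; exact: dist'.
Qed.

(** Iterating [F] from [u0] stays in [U] and converges geometrically. This stands in for the power
    series of square roots and of the inverse of [1 - h]. *)
Lemma contraction_fixed (U : set V) (F : V -> V) (q : R) (u0 : V) :
  0 <= q -> q < 1 -> U u0 -> (forall u, U u -> U (F u)) ->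
  (forall u v, U u -> U v -> nrm (F u - F v) <= q * nrm (u - v)) ->
  limit_closed U -> exists2 l, U l & F l = l.
Proof.
move=> q0 q1 U0 UF lip clU; pose u n := iter n F u0.
have Uu n : U (u n) by elim: n => //= n; exact: UF.
have [n|l lE] := @geometric_cauchy_cvg u (nrm (F u0 - u0)) q q0 q1.
  elim: n => [|n IH]; first by rewrite expr0 mulr1.
  by rewrite (le_trans (lip _ _ (Uu n.+1) (Uu n))) // exprS mulrCA ler_wpM2l.
have lim_l (e : R) : 0 < e -> exists n, nrm (u n - l) < e.
  move=> e0; set C := _ / _ in lE.
  have C0 : 0 < C + 1 by rewrite ltr_wpDl // divr_ge0 ?nrm_ge0 // ltW // subr_gt0.
  have [n qn] := geometric_small q0 q1 (divr_gt0 e0 C0); exists n.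
  rewrite (le_lt_trans (lE n)) //; move: qn; rewrite ltr_pdivlMr //.
  by apply: le_lt_trans; rewrite mulrC ler_wpM2l ?exprn_ge0 // lerDl.
have Ul : U l by apply: clU => e /lim_l [n ne]; exists (u n).
(* For a suitable [n], both [F l] and [l] are within [e / 2] of [F (u n)]. *)
exists l => //; apply/eqP; rewrite -subr_eq0; apply/eqP/nrm_lim0 => e e0.
have e2 : 0 < e / 2 by rewrite divr_gt0.
set C := _ / _ in lE.
have C0 : 0 < C + 1 by rewrite ltr_wpDl // divr_ge0 ?nrm_ge0 // ltW // subr_gt0.
have [n qn] := geometric_small q0 q1 (divr_gt0 e2 C0).
have bnd : C * q ^+ n < e / 2.
  move: qn; rewrite ltr_pdivlMr //.
  by apply: le_lt_trans; rewrite mulrC ler_wpM2l ?exprn_ge0 // lerDl.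
have le1 : nrm (F l - F (u n)) < e / 2.
  rewrite (le_lt_trans (lip _ _ Ul (Uu _))) // (le_lt_trans _ bnd) // nrmBC.
  by rewrite (le_trans _ (lE n)) // ler_piMl ?nrm_ge0 // ltW.
have le2 : nrm (u n.+1 - l) < e / 2.
  rewrite (le_lt_trans (lE _)) // (le_lt_trans _ bnd) // ler_wpM2l //.
    by rewrite divr_ge0 ?nrm_ge0 // ltW // subr_gt0.
  by rewrite exprS ler_piMl ?exprn_ge0 // ltW.
rewrite -(subrKA (F (u n))) (le_lt_trans (nrmD _ _)) //.
by rewrite [ltRHS](splitr e) ltrD.
Qed.

Lemma limit_closed_ker (W : normedModType R[i]) (G : V -> W) (K : R) :
  {morph G : u v / u - v} -> (forall u, nrm (G u) <= K * nrm u) ->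
  limit_closed [set u | G u = 0].
Proof.
move=> GB GK l l_lim; apply/nrm_lim0 => e e0.
have K0 : 0 < `|K| + 1 by rewrite ltr_wpDl.
have [u Gu ue] := l_lim _ (divr_gt0 e0 K0).
rewrite -nrmN -sub0r -[0]Gu -GB (le_lt_trans (GK _)) //.
move: ue; rewrite ltr_pdivlMr // mulrC; apply: le_lt_trans.
by rewrite ler_wpM2r ?nrm_ge0 // ler_wpDr // ler_norm.
Qed.

Lemma limit_closed_ball (q : R) : limit_closed [set u : V | nrm u <= q].
Proof.
move=> l l_lim /=; rewrite leNgt; apply/negP => ql.
have [|u uq] := l_lim (nrm l - q); first by rewrite subr_gt0.
rewrite ltNge => /negP; apply.
rewrite lerBlDl -[in leLHS](subrK u l) addrC (le_trans (nrmD _ _)) //.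
by rewrite lerD // nrmBC.
Qed.

End FixedPoint.

Lemma linearP_fun (K : pzRingType) (U W : lmodType K) (f : U -> W) : linear f ->
  [/\ f 0 = 0, forall u v, f (u + v) = f u + f v,
      forall a u, f (a *: u) = a *: f u,
      forall u, f (- u) = - f u & forall u v, f (u - v) = f u - f v].
Proof.
move=> fl.
have f0 : f 0 = 0 by have := fl (-1) 0 0; rewrite scaler0 addr0 scaleN1r addNr.
have fZ a u : f (a *: u) = a *: f u by have := fl a u 0; rewrite !addr0 f0 addr0.
have fD u v : f (u + v) = f u + f v by have := fl 1 u v; rewrite !scale1r.
have fN u : f (- u) = - f u by rewrite -scaleN1r fZ scaleN1r.
by split=> // u v; rewrite fD fN.
Qed.

(** * Algebra in a C*-category *)

Section Bilinearity.
Context {R : realType} {T : cstar_category R}.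
Implicit Types ρ σ τ : T.

Lemma comp0l ρ σ τ (s : arrow ρ σ) : (0 : arrow σ τ) ∘ s = 0.
Proof. by have [] := linearP_fun (@comp_linear_l _ _ _ _ τ s). Qed.
Lemma compDl ρ σ τ (t t' : arrow σ τ) (s : arrow ρ σ) : (t + t') ∘ s = t ∘ s + t' ∘ s.
Proof. by have [] := linearP_fun (@comp_linear_l _ _ _ _ τ s). Qed.
Lemma compZl ρ σ τ a (t : arrow σ τ) (s : arrow ρ σ) : (a *: t) ∘ s = a *: (t ∘ s).
Proof. by have [] := linearP_fun (@comp_linear_l _ _ _ _ τ s). Qed.
Lemma compNl ρ σ τ (t : arrow σ τ) (s : arrow ρ σ) : (- t) ∘ s = - (t ∘ s).
Proof. by have [] := linearP_fun (@comp_linear_l _ _ _ _ τ s). Qed.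
Lemma compBl ρ σ τ (t t' : arrow σ τ) (s : arrow ρ σ) : (t - t') ∘ s = t ∘ s - t' ∘ s.
Proof. by have [] := linearP_fun (@comp_linear_l _ _ _ _ τ s). Qed.
Lemma comp0r ρ σ τ (t : arrow σ τ) : t ∘ (0 : arrow ρ σ) = 0.
Proof. by have [] := linearP_fun (@comp_linear_r _ _ ρ _ _ t). Qed.
Lemma compDr ρ σ τ (t : arrow σ τ) (s s' : arrow ρ σ) : t ∘ (s + s') = t ∘ s + t ∘ s'.
Proof. by have [] := linearP_fun (@comp_linear_r _ _ ρ _ _ t). Qed.
Lemma compZr ρ σ τ a (t : arrow σ τ) (s : arrow ρ σ) : t ∘ (a *: s) = a *: (t ∘ s).
Proof. by have [] := linearP_fun (@comp_linear_r _ _ ρ _ _ t). Qed.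
Lemma compBr ρ σ τ (t : arrow σ τ) (s s' : arrow ρ σ) : t ∘ (s - s') = t ∘ s - t ∘ s'.
Proof. by have [] := linearP_fun (@comp_linear_r _ _ ρ _ _ t). Qed.
Lemma comp_suml ρ σ τ (I : Type) (r : seq I) (P : pred I) (F : I -> arrow σ τ)
    (s : arrow ρ σ) :
  (\sum_(i <- r | P i) F i) ∘ s = \sum_(i <- r | P i) F i ∘ s.
Proof. by apply: (big_morph (fun t => t ∘ s)) => [t t'|]; rewrite ?compDl ?comp0l. Qed.
Lemma comp_sumr ρ σ τ (I : Type) (r : seq I) (P : pred I) (F : I -> arrow ρ σ)
    (t : arrow σ τ) :
  t ∘ (\sum_(i <- r | P i) F i) = \sum_(i <- r | P i) t ∘ F i.
Proof. by apply: (big_morph (fun s => t ∘ s)) => [s s'|]; rewrite ?compDr ?comp0r. Qed.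

Lemma starD ρ σ (t s : arrow ρ σ) : (t + s)^† = t^† + s^†.
Proof. by have := star_antilinear 1 t s; rewrite rmorph1 !scale1r. Qed.
Lemma star0 ρ σ : (0 : arrow ρ σ)^† = 0.
Proof. by apply: (addrI (0^†)); rewrite -starD !addr0. Qed.
Lemma starZ ρ σ (a : R[i]) (t : arrow ρ σ) : (a *: t)^† = (a^*)%C *: t^†.
Proof. by have := star_antilinear a t 0; rewrite star0 !addr0. Qed.
Lemma starZ_real ρ σ (a : R) (t : arrow ρ σ) : (a%:C *: t)^† = a%:C *: t^†.
Proof. by rewrite starZ /= oppr0. Qed.
Lemma starN ρ σ (t : arrow ρ σ) : (- t)^† = - t^†.
Proof. by apply: (addrI (t^†)); rewrite -starD !subrr star0. Qed.
Lemma starB ρ σ (t s : arrow ρ σ) : (t - s)^† = t^† - s^†.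
Proof. by rewrite starD starN. Qed.

Lemma nrm_star ρ σ (t : arrow ρ σ) : nrm (t^†) = nrm t.
Proof. by rewrite /nrm norm_star. Qed.
Lemma nrm_comp ρ σ τ (t : arrow σ τ) (s : arrow ρ σ) : nrm (t ∘ s) <= nrm t * nrm s.
Proof. by have := norm_comp t s; rewrite !norm_nrm -rmorphM /= lecR. Qed.
Lemma nrm_cstar ρ σ (t : arrow ρ σ) : nrm (t^† ∘ t) = nrm t ^+ 2.
Proof.
by have := cstar_identity t; rewrite !norm_nrm -rmorphXn /= => /complexI.
Qed.
(** The C*-identity makes the norm idempotent, hence 0 or 1; the value 0 occurs when [idn ρ = 0]. *)
Lemma nrm_idn ρ : nrm (idn ρ) <= 1.
Proof.
have := nrm_cstar (idn ρ); rewrite star_id compid.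
have [->|n0] := eqVneq (nrm (idn ρ)) 0; first by rewrite ler01.
by rewrite expr2 -{1}[nrm _]mulr1 => /(mulfI n0) <-.
Qed.

End Bilinearity.

(** * Square roots, and contractivity of unital star morphisms *)

Section EndomorphismAlgebra.
Context {R : realType} {T : cstar_category R}.
Implicit Types ρ σ τ : T.

Lemma nrm_isometry ρ σ (u : arrow ρ σ) : u^† ∘ u = idn ρ -> nrm u <= 1.
Proof.
move=> uu; rewrite -(@ler_pXn2r _ 2) ?nnegrE ?nrm_ge0 // expr1n -nrm_cstar uu.
exact: nrm_idn.
Qed.

Let half : R[i] := (2^-1 : R)%:C.

(* [a + i b] is unitary, and [a] is the average of it and its adjoint. *)
Lemma nrm_unitary_part ρ (a b : arrow ρ ρ) : a^† = a -> b^† = b ->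
  a ∘ b = b ∘ a -> a ∘ a + b ∘ b = idn ρ -> nrm a <= 1.
Proof.
move=> aa bb ab ab1; pose u := a + imag *: b.
have uS : u^† = a - imag *: b.
  rewrite starD starZ aa bb -scaleNr; congr (_ + _ *: _).
  by apply/eqP; rewrite eq_complex /imag /= oppr0 !eqxx.
have u1 : nrm u <= 1.
  apply: nrm_isometry; rewrite uS /u !(compDl, compDr, compNl, compZl, compZr).
  by rewrite ab scalerA -expr2 sqr_imag scaleN1r opprK addrA addrK.
have -> : a = half *: u + half *: u^†.
  by rewrite -scalerDr uS addrACA subrr addr0 scalerDr scale_halfD.
rewrite (le_trans (nrmD _ _)) // !nrmZ nrm_star -mulrDl cabs_real ger0_norm ?invr_ge0 //.
by rewrite (_ : 2^-1 + 2^-1 = 1) ?mul1r //; field.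
Qed.

(** Take [c = 1 - y] with [y] the fixed point of [y ↦ (h^2 + y^2) / 2], a contraction of ratio
    [nrm h] on the ball of that radius: [2 y = h^2 + y^2] gives [(1 - y)^2 = 1 - h^2]. Commutation
    with everything that commutes with [h] is carried along in [U]. *)
Lemma sqrt_one_sub_sqr ρ (h : arrow ρ ρ) : h^† = h -> nrm h < 1 ->
  exists c : arrow ρ ρ, [/\ c^† = c, c ∘ c = idn ρ - h ∘ h
    & forall z, z ∘ h = h ∘ z -> z ∘ c = c ∘ z].
Proof.
move=> hh h1; set q := nrm h in h1.
have q0 : 0 <= q := nrm_ge0 _.
pose U : set (arrow ρ ρ) := [set y | [/\ y^† = y, nrm y <= q
  & forall z, z ∘ h = h ∘ z -> z ∘ y = y ∘ z]].
pose F (y : arrow ρ ρ) := half *: (h ∘ h + y ∘ y).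
have [||y y'|l l_lim|y [yy yq yh] Fy] := @contraction_fixed _ _ U F q 0 q0 h1.
- by split=> [||z]; rewrite ?star0 ?nrm0 ?comp0l ?comp0r.
- move=> y [yy yq yh]; split=> [||z zh].
  + by rewrite /F starZ_real starD !star_compose hh yy.
  + rewrite /F nrmZ cabs_real ger0_norm ?invr_ge0 //.
    rewrite (@le_trans _ _ (2^-1 * (q * 1 + q * 1))) //; last first.
      by rewrite le_eqVlt; apply/orP; left; apply/eqP; field.
    rewrite ler_wpM2l ?invr_ge0 // (le_trans (nrmD _ _)) // lerD //.
      by rewrite (le_trans (nrm_comp _ _)) // ler_wpM2l // ltW.
    by rewrite (le_trans (nrm_comp _ _)) // ler_pM ?nrm_ge0 // (le_trans yq) // ltW.
  + rewrite /F compZl compZr compDl compDr; congr (_ *: (_ + _)).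
      by rewrite compA zh -compA zh compA.
    by rewrite compA (yh _ zh) -compA (yh _ zh) compA.
- move=> [_ yq _] [_ yq' _].
  rewrite /F -scalerBr nrmZ cabs_real ger0_norm ?invr_ge0 //.
  rewrite opprD addrACA subrr add0r.
  have -> : y ∘ y - y' ∘ y' = y ∘ (y - y') + (y - y') ∘ y'.
    by rewrite compBr compBl subrKA.
  rewrite mulrC ler_pdivrMr // (le_trans (nrmD _ _)) // mulr_natr mulr2n.
  rewrite lerD // (le_trans (nrm_comp _ _)) //; first by rewrite ler_wpM2r ?nrm_ge0.
  by rewrite mulrC ler_wpM2r ?nrm_ge0.
(* Membership in [U] is a conjunction of closed conditions, each passed to the limit separately. *)
- have lim_in (B : set (arrow ρ ρ)) : U `<=` B -> limit_closed B -> B l.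
    move=> UB clB; apply: clB => e /l_lim [u /UB Bu ue]; by exists u.
  split=> [||z zh].
  + apply/eqP; rewrite -subr_eq0; apply/eqP.
    apply: (lim_in [set y : arrow ρ ρ | y^† - y = 0]) => [y [yy _ _] /=|].
      by rewrite yy subrr.
    apply: (@limit_closed_ker _ _ _ (fun y : arrow ρ ρ => y^† - y) 2) => [u v|u].
      by rewrite starB !opprD addrACA.
    by rewrite mulr2n mulrDl mul1r (le_trans (nrmB _ _)) // nrm_star.
  + by apply: (lim_in [set y | nrm y <= q]) => [y []|]; last exact: limit_closed_ball.
  + apply/eqP; rewrite -subr_eq0; apply/eqP.
    apply: (lim_in [set y : arrow ρ ρ | z ∘ y - y ∘ z = 0]) => [y [_ _ yh] /=|].
      by rewrite yh ?subrr.
    apply: (@limit_closed_ker _ _ _ (fun y : arrow ρ ρ => z ∘ y - y ∘ z) (nrm z + nrm z)).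
      by move=> u v; rewrite compBr compBl !opprD addrACA.
    move=> u; rewrite mulrDl (le_trans (nrmB _ _)) // lerD ?nrm_comp //.
    by rewrite mulrC nrm_comp.
exists (idn ρ - y); split=> [||z zh].
- by rewrite starB star_id yy.
- rewrite compBr !compBl !compid idcomp.
  have yE : y + y = h ∘ h + y ∘ y by rewrite -{1 2}Fy /F scale_halfD.
  rewrite -addrA -opprD; congr (_ - _).
  by rewrite addrA yE addrK.
- by rewrite compBl compBr compid idcomp yh.
Qed.

(** With [c] the square root of [1 - h^2], the arrow [c + i h] is unitary, so that [c] has norm at
    most one. This replaces an appeal to positivity. *)
Lemma nrm_one_sub_sqr ρ (h : arrow ρ ρ) : h^† = h -> nrm h < 1 ->
  nrm (idn ρ - h ∘ h) <= 1.
Proof.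
move=> hh h1; have [c [cc c2 ch]] := sqrt_one_sub_sqr hh h1.
rewrite -c2 -{1}cc nrm_cstar expr_le1 ?nrm_ge0 //.
by apply: nrm_unitary_part cc hh (esym (ch _ erefl)) _; rewrite c2 subrK.
Qed.

(** For self-adjoint [h] of norm below one, [φ h + i φ c] is unitary, with [c] the square root of
    [1 - h^2]. Rescaling covers all self-adjoint arrows, and the C*-identity applied to [f^† ∘ f]
    covers the rest. *)
Lemma nrm_star_morphism ρ σ (φ : arrow ρ ρ -> arrow σ σ) : linear φ ->
  φ (idn ρ) = idn σ -> {morph φ : f g / f ∘ g} ->
  (forall f, φ (f^†) = (φ f)^†) -> forall f, nrm (φ f) <= nrm f.
Proof.
move=> φl φ1 φM φS; have [φ0 φD φZ φN φB] := linearP_fun φl.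
have unit_ball h : h^† = h -> nrm h < 1 -> nrm (φ h) <= 1.
  move=> hh h1; have [c [cc c2 ch]] := sqrt_one_sub_sqr hh h1.
  apply: (@nrm_unitary_part _ (φ h) (φ c)); rewrite -?φS ?hh ?cc -?φM //.
    by rewrite ch.
  by rewrite c2 -φD addrC subrK.
have self_adjoint h : h^† = h -> nrm (φ h) <= nrm h.
  move=> hh; apply/ler_addgt0Pr => e e0.
  have n0 : 0 < nrm h + e by rewrite ltr_wpDl ?nrm_ge0.
  have := unit_ball ((nrm h + e)^-1%:C *: h).
  rewrite starZ_real hh φZ !nrmZ cabs_real ger0_norm ?invr_ge0 ?(ltW n0) //.
  rewrite mulrC ltr_pdivrMr // mul1r ltrDl => /(_ erefl e0).
  by rewrite mulrC ler_pdivrMr // mul1r.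
move=> f; rewrite -(@ler_pXn2r _ 2) ?nnegrE ?nrm_ge0 // -!nrm_cstar -φS -φM.
by apply: self_adjoint; rewrite star_compose starK.
Qed.

End EndomorphismAlgebra.

(** * Strict tensor products *)

(* Arrows with their source and target packed, so that the strict tensor product becomes
   associative and unital for Leibniz equality; composition is total, with a junk value on
   pairs of arrows that do not match. *)
Section PackedArrows.
Context {R : realType} {T : tensor_cstar_category R}.
Implicit Types ρ σ τ : T.

Record packed := Packed { dom : T; cod : T; packed_arrow : arrow dom cod }.
Definition pack ρ σ (t : arrow ρ σ) : packed := Packed t.
Implicit Types A B C : packed.

Definition pid ρ := pack (idn ρ).
Definition ptens A B := pack (packed_arrow A ⊗ packed_arrow B).
Definition pcomp A B :=
  if pselect (cod B = dom A) is left e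
  then pack (packed_arrow A ∘ hcast erefl e (packed_arrow B)) else A.

Lemma pack_hcast ρ ρ' σ σ' (e : ρ = ρ') (e' : σ = σ') (t : arrow ρ σ) :
  pack (hcast e e' t) = pack t.
Proof. by case: _ / e; case: _ / e'. Qed.

Lemma hcastK ρ σ (e : ρ = ρ) (e' : σ = σ) (t : arrow ρ σ) : hcast e e' t = t.
Proof. by rewrite (Prop_irrelevance e erefl) (Prop_irrelevance e' erefl). Qed.

(** The way back to typed equalities: equal packed arrows differ by casts along [ρ = ρ] and [σ = σ],
    which are trivial by proof irrelevance. *)
Lemma pack_inj ρ σ : injective (@pack ρ σ).
Proof.
move=> t s ts.
have : forall A B, A = B -> exists e e', hcast e e' (packed_arrow A) = packed_arrow B.
  by move=> A _ <-; exists erefl, erefl.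
by move=> /(_ _ _ ts) [e [e']] /=; rewrite hcastK.
Qed.

Lemma pack_tens ρ σ ρ' σ' (t : arrow ρ σ) (t' : arrow ρ' σ') :
  pack (t ⊗ t') = ptens (pack t) (pack t').
Proof. by []. Qed.

Lemma pack_comp ρ σ τ (t : arrow σ τ) (s : arrow ρ σ) :
  pack (t ∘ s) = pcomp (pack t) (pack s).
Proof. by rewrite /pcomp; case: pselect => // e; rewrite [hcast _ _ _]hcastK. Qed.

Lemma pid_tob ρ σ : pid (ρ ⊙ σ) = ptens (pid ρ) (pid σ).
Proof. by rewrite /pid -pack_tens tens_id. Qed.

Lemma ptensA A B C : ptens A (ptens B C) = ptens (ptens A B) C.
Proof. by case: A B C => ? ? t [? ? t'] [? ? t'']; rewrite -!pack_tens -tensA pack_hcast. Qed.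

Lemma ptens1l A : ptens (pid ι) A = A.
Proof.
case: A => ? ? t; rewrite /pid -[Packed t]/(pack t) -pack_tens.
by rewrite -[RHS](congr1 _ (tens1l t)) pack_hcast.
Qed.

Lemma ptens1r A : ptens A (pid ι) = A.
Proof.
case: A => ? ? t; rewrite /pid -[Packed t]/(pack t) -pack_tens.
by rewrite -[RHS](congr1 _ (tens1r t)) pack_hcast.
Qed.

Lemma pcompP A B : cod B = dom A ->
  exists ρ σ τ (t : arrow σ τ) (s : arrow ρ σ),
    [/\ A = pack t, B = pack s & pcomp A B = pack (t ∘ s)].
Proof.
case: A B => σ τ t [ρ σ' s] /= e; case: _ / e t => t.
by exists ρ, σ', τ, t, s; rewrite pack_comp.
Qed.

Lemma dom_pcomp A B : cod B = dom A -> dom (pcomp A B) = dom B.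
Proof. by move=> /pcompP [? [? [? [t [s [-> -> ->]]]]]]. Qed.

Lemma cod_pcomp A B : cod (pcomp A B) = cod A.
Proof. by rewrite /pcomp; case: pselect. Qed.

Lemma pcomp1l ρ A : cod A = ρ -> pcomp (pid ρ) A = A.
Proof. by case: A => ? ? t /= <-; rewrite -[Packed t]/(pack t) -pack_comp idcomp. Qed.

Lemma pcomp1r ρ A : dom A = ρ -> pcomp A (pid ρ) = A.
Proof. by case: A => ? ? t /= <-; rewrite -[Packed t]/(pack t) -pack_comp compid. Qed.

Lemma pcompA A B C : cod C = dom B -> cod B = dom A ->
  pcomp A (pcomp B C) = pcomp (pcomp A B) C.
Proof.
case: A B C => ? ? t [? ? s] [? ? r] /= e e'.
case: _ / e' t => t; case: _ / e s t => s t.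
by rewrite -[Packed t]/(pack t) -[Packed s]/(pack s) -[Packed r]/(pack r) -!pack_comp compA.
Qed.

Lemma ptens_pcomp A B A' B' : cod B = dom A -> cod B' = dom A' ->
  ptens (pcomp A B) (pcomp A' B') = pcomp (ptens A A') (ptens B B').
Proof.
move=> /pcompP [? [? [? [t [s [-> -> ->]]]]]] /pcompP [? [? [? [t' [s' [-> -> ->]]]]]].
by rewrite -!pack_tens -pack_comp tens_comp.
Qed.

Lemma ptens_pidl ρ A B : cod B = dom A ->
  ptens (pid ρ) (pcomp A B) = pcomp (ptens (pid ρ) A) (ptens (pid ρ) B).
Proof. by move=> e; rewrite -ptens_pcomp // pcomp1l. Qed.

Lemma ptens_pidr ρ A B : cod B = dom A ->
  ptens (pcomp A B) (pid ρ) = pcomp (ptens A (pid ρ)) (ptens B (pid ρ)).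
Proof. by move=> e; rewrite -ptens_pcomp // pcomp1l. Qed.

Lemma pack_lact ρ σ f (t : arrow ρ σ) : pack (lact f t) = ptens (pack f) (pack t).
Proof. by rewrite /lact pack_hcast pack_tens. Qed.

Lemma pack_ract ρ σ f (t : arrow ρ σ) : pack (ract t f) = ptens (pack t) (pack f).
Proof. by rewrite /ract pack_hcast pack_tens. Qed.

Lemma ptens_slide A B : ptens A B = pcomp (ptens A (pid (cod B))) (ptens (pid (dom A)) B).
Proof. by rewrite -ptens_pcomp // pcomp1l // pcomp1r. Qed.
Lemma ptens_slide' A B : ptens A B = pcomp (ptens (pid (cod A)) B) (ptens A (pid (dom B))).
Proof. by rewrite -ptens_pcomp // pcomp1l // pcomp1r. Qed.

End PackedArrows.

(** * The action of (ι,ι) on arrows *)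

Section UnitActionTheory.
Context {R : realType} {T : symmetric_tensor_cstar_category R}.
Implicit Types (ρ σ τ : T) (f g : arrow (ι : T) ι).

(** Naturality of the symmetry at [f ⊗ t], where both symmetries involved have a factor ι and are
    identities up to casts. *)
Lemma lact_ract ρ σ f (t : arrow ρ σ) : lact f t = ract t f.
Proof.
apply: pack_inj; rewrite pack_lact pack_ract.
have symE υ : pack (symmetry ι υ) = pid (υ : T) by rewrite /pid -sym1l pack_hcast.
have := congr1 (@pack _ T _ _) (sym_natural f t).
by rewrite !pack_comp !symE !pack_tens pcomp1l ?pcomp1r //; [exact: tob1r|exact: tob1l].
Qed.

Lemma unit_central f : central f.
Proof. by move=> ρ; rewrite lact_ract. Qed.

Lemma lact_compl ρ σ τ f (t : arrow σ τ) (s : arrow ρ σ) :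
  lact f (t ∘ s) = lact f t ∘ s.
Proof.
apply: pack_inj; rewrite pack_comp !pack_lact pack_comp.
by rewrite -[X in ptens X _](pcomp1r (ρ := ι)) // ptens_pcomp // ptens1l.
Qed.

Lemma lact_compr ρ σ τ f (t : arrow σ τ) (s : arrow ρ σ) :
  lact f (t ∘ s) = t ∘ lact f s.
Proof.
apply: pack_inj; rewrite pack_comp !pack_lact pack_comp.
by rewrite -[X in ptens X _](pcomp1l (ρ := ι)) // ptens_pcomp // ptens1l.
Qed.

Lemma lact_tensr ρ σ ρ' σ' f (t : arrow ρ σ) (s : arrow ρ' σ') :
  lact f (t ⊗ s) = t ⊗ lact f s.
Proof.
apply: pack_inj; rewrite pack_tens !pack_lact pack_tens ptensA.
by rewrite -pack_lact lact_ract pack_ract ptensA.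
Qed.

Lemma lact_unit f g : lact f g = f ∘ g.
Proof.
apply: pack_inj; rewrite pack_lact pack_comp ptens_slide.
by rewrite -/(pid ι) /= ptens1l ptens1r.
Qed.

(** Both composites equal [f ⊗ g]: one as the left action of [f] on [g], the other as the right
    action of [g] on [f]. *)
Lemma unit_compC f g : f ∘ g = g ∘ f.
Proof.
rewrite -!lact_unit [RHS]lact_ract; apply: pack_inj; by rewrite pack_ract pack_lact.
Qed.

Lemma lact_lact ρ σ f g (t : arrow ρ σ) : lact f (lact g t) = lact (f ∘ g) t.
Proof. by apply: pack_inj; rewrite -lact_unit !pack_lact ptensA. Qed.

Lemma lact_comp ρ σ τ f g (t : arrow σ τ) (s : arrow ρ σ) :
  lact f t ∘ lact g s = lact (f ∘ g) (t ∘ s).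
Proof. by rewrite -lact_compl -lact_compr lact_lact. Qed.

Lemma lact1 ρ σ (t : arrow ρ σ) : lact (idn ι) t = t.
Proof. exact: tens1l. Qed.

Lemma hcast_star ρ ρ' σ σ' (e : ρ = ρ') (e' : σ = σ') (t : arrow ρ σ) :
  (hcast e e' t)^† = hcast e' e (t^†).
Proof. by case: _ / e; case: _ / e'. Qed.

Lemma nrm_hcast ρ ρ' σ σ' (e : ρ = ρ') (e' : σ = σ') (t : arrow ρ σ) :
  nrm (hcast e e' t) = nrm t.
Proof. by case: _ / e; case: _ / e'. Qed.

Lemma lact_star ρ σ f (t : arrow ρ σ) : (lact f t)^† = lact (f^†) (t^†).
Proof. by rewrite /lact hcast_star tens_star. Qed.

Lemma lact_linear_r ρ σ f : linear (fun t : arrow ρ σ => lact f t).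
Proof. by move=> a t s; rewrite /lact tens_linear_r hcast_linear. Qed.

Lemma lactDr ρ σ f (t s : arrow ρ σ) : lact f (t + s) = lact f t + lact f s.
Proof. by have [] := linearP_fun (@lact_linear_r ρ σ f). Qed.
Lemma lactZr ρ σ f a (t : arrow ρ σ) : lact f (a *: t) = a *: lact f t.
Proof. by have [] := linearP_fun (@lact_linear_r ρ σ f). Qed.
Lemma lact0l ρ σ (t : arrow ρ σ) : lact 0 t = 0.
Proof. by have [] := linearP_fun (lact_linear t). Qed.
Lemma lactDl ρ σ f g (t : arrow ρ σ) : lact (f + g) t = lact f t + lact g t.
Proof. by have [] := linearP_fun (lact_linear t). Qed.
Lemma lactBl ρ σ f g (t : arrow ρ σ) : lact (f - g) t = lact f t - lact g t.
Proof. by have [] := linearP_fun (lact_linear t). Qed.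
Lemma lactZl ρ σ a f (t : arrow ρ σ) : lact (a *: f) t = a *: lact f t.
Proof. by have [] := linearP_fun (lact_linear t). Qed.

End UnitActionTheory.

(** * Norm bounds for tensoring with an identity *)

Section TensorNorm.
Context {R : realType} {T : tensor_cstar_category R}.
Implicit Types ρ σ τ : T.

(** The tensor structure carries no norm axiom. The bound comes from [s ↦ 1 ⊗ s] being a unital star
    morphism on endomorphisms, applied to [t^† ∘ t]. *)
Lemma nrm_tens_idl ρ σ τ (t : arrow ρ σ) : nrm (idn τ ⊗ t) <= nrm t.
Proof.
rewrite -(@ler_pXn2r _ 2) ?nnegrE ?nrm_ge0 // -!nrm_cstar tens_star -tens_comp.
rewrite star_id compid.
apply: (nrm_star_morphism (φ := fun s : arrow ρ ρ => idn τ ⊗ s)).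
- exact: tens_linear_r.
- exact: tens_id.
- by move=> f g; rewrite -tens_comp compid.
- by move=> f; rewrite tens_star star_id.
Qed.

Lemma nrm_tens_idr ρ σ τ (t : arrow ρ σ) : nrm (t ⊗ idn τ) <= nrm t.
Proof.
rewrite -(@ler_pXn2r _ 2) ?nnegrE ?nrm_ge0 // -!nrm_cstar tens_star -tens_comp.
rewrite star_id compid.
apply: (nrm_star_morphism (φ := fun s : arrow ρ ρ => s ⊗ idn τ)).
- exact: tens_linear_l.
- exact: tens_id.
- by move=> f g; rewrite -tens_comp compid.
- by move=> f; rewrite tens_star star_id.
Qed.

End TensorNorm.

Section LactNorm.
Context {R : realType} {T : symmetric_tensor_cstar_category R}.

Lemma nrm_lact (ρ σ : T) f (t : arrow ρ σ) : nrm (lact f t) <= nrm f * nrm t.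
Proof.
rewrite -[t in leLHS]idcomp lact_compl (le_trans (nrm_comp _ _)) //.
rewrite ler_wpM2r ?nrm_ge0 // /lact nrm_hcast; exact: nrm_tens_idr.
Qed.

End LactNorm.

(** * Words in the adjacent transpositions *)

Section CoxeterWords.
Variables (M : Type) (op : M -> M -> M) (e : M).
Hypothesis opA : forall x y z, op x (op y z) = op (op x y) z.
Hypothesis ope : forall x, op x e = x.
Hypothesis eop : forall x, op e x = x.

(** Type [A_n], for permutations of [n + 1] letters; [s] is total, but only its values below [n] are
    constrained. *)
Definition coxeter_relations n (s : nat -> M) : Prop :=
  [/\ forall i, (i < n)%N -> op (s i) (s i) = e,
      forall i, (i.+1 < n)%N ->
        op (s i) (op (s i.+1) (s i)) = op (s i.+1) (op (s i) (s i.+1))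
    & forall i j, (i.+1 < j)%N -> (j < n)%N -> op (s i) (s j) = op (s j) (s i)].

Definition word_eval (s : nat -> M) (w : seq nat) : M :=
  foldr (fun i x => op (s i) x) e w.

Variable s : nat -> M.

Lemma word_eval_cat w v : word_eval s (w ++ v) = op (word_eval s w) (word_eval s v).
Proof. by elim: w => [|i w IH] /=; rewrite ?eop // IH opA. Qed.

Lemma word_eval_rcons w i : word_eval s (rcons w i) = op (word_eval s w) (s i).
Proof. by rewrite -cats1 word_eval_cat /= ope. Qed.

Lemma word_eval_comm w j : (forall i, i \in w -> op (s i) (s j) = op (s j) (s i)) ->
  op (word_eval s w) (s j) = op (s j) (word_eval s w).
Proof.
elim: w => [|i w IH] ij /=; first by rewrite eop ope.
rewrite -opA IH => [|k kw]; last by rewrite ij // inE kw orbT.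
by rewrite opA ij ?inE ?eqxx // opA.
Qed.

(* The words [k + m - 1, ..., k + 1, k] with [k + m = n] represent the cosets of the
   symmetric group of [n] letters in that of [n + 1] letters. *)
Fixpoint descending k m : seq nat := if m is m'.+1 then (k + m')%N :: descending k m' else [::].

Lemma mem_descending k m i : (i \in descending k m) = (k <= i < k + m)%N.
Proof.
elim: m => [|m IH]; first by rewrite in_nil; lia.
by rewrite inE IH; lia.
Qed.

Lemma descending_rcons k m : descending k m.+1 = rcons (descending k.+1 m) k.
Proof.
elim: m => [|m IH]; first by rewrite /= addn0.
by rewrite -[LHS]/((k + m.+1)%N :: descending k m.+1) IH /= addSnnS.
Qed.

Variable n : nat.
Hypothesis rels : coxeter_relations n s.

(** The letter [j] commutes with the lower part of the word until it meets [j] and [j - 1]; the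
    braid relation turns it into [j - 1], which commutes with the letters above. *)
Lemma descending_shift k m j : (k < j)%N -> (j < k + m)%N -> (k + m <= n)%N ->
  op (word_eval s (descending k m)) (s j) = op (s j.-1) (word_eval s (descending k m)).
Proof.
have [_ braid far] := rels.
elim: m => [|m IH] kj; first by rewrite addn0 => jk; move: (ltn_trans kj jk); rewrite ltnn.
rewrite addnS ltnS leq_eqVlt => /predU1P[jE|jkm] kmn; last first.
  by rewrite /= -opA IH //; [rewrite !opA -[op (s (k + m)%N) _]far //; lia | lia].
case: m jE kmn {IH} => [|m] jE kmn; first by move: kj; rewrite jE addn0 ltnn.
rewrite {j}jE addnS in kj kmn *; rewrite /= addnS.
have comm : op (word_eval s (descending k m)) (s (k + m).+1) =
    op (s (k + m).+1) (word_eval s (descending k m)).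
  apply: word_eval_comm => i; rewrite mem_descending => /andP[_ ikm].
  by rewrite far //; lia.
rewrite -!opA comm !opA; congr op.
by rewrite -!opA braid ?opA //; lia.
Qed.

End CoxeterWords.

(** Append one letter [j] to a normal form. If [j = k] it cancels the last letter, if [j = k - 1] it
    lengthens the descending word, if [j < k - 1] it commutes through into [v], and if [j > k] it
    passes into [v] as [j - 1]. The empty word has [k = n + 1] and [m = 0]. *)
Lemma coxeter_normal_form (M : Type) (op : M -> M -> M) (e : M)
    (opA : forall x y z, op x (op y z) = op (op x y) z)
    (ope : forall x, op x e = x) (eop : forall x, op e x = x)
    (s : nat -> M) n (rels : coxeter_relations op e n.+1 s) w :
  all (fun i => i < n.+1)%N w -> exists v k m,
    [/\ all (fun i => i < n)%N v, (k + m = n.+1)%N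
      & word_eval op e s w = op (word_eval op e s v) (word_eval op e s (descending k m))].
Proof.
have [invol braid far] := rels.
elim/last_ind: w => [|w j IH]; first by exists [::], n.+1, 0%N; rewrite addn0 /= ope.
rewrite all_rcons => /andP[jn /IH [v [k [m [vn kmn wE]]]]].
rewrite (word_eval_rcons opA) // wE -opA.
have [jk|kj|jk] := ltngtP j k; last 1 first.
- case: m kmn wE => [|m] kmn wE.
    by move: jn; rewrite jk; lia.
  exists v, k.+1, m; split; rewrite ?addSnnS //.
  rewrite descending_rcons (word_eval_rcons opA) // -opA jk invol ?ope //; lia.
- have [jk'|kj'] := ltnP j.+1 k.
    exists (rcons v j), k, m; split=> //.
      by rewrite all_rcons vn andbT; lia.
    rewrite (word_eval_rcons opA) // -opA; congr op.
    apply: word_eval_comm => // i; rewrite mem_descending => /andP[ki ik].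
    by rewrite [RHS]far //; lia.
  have kE : k = j.+1 by apply/eqP; rewrite eqn_leq kj' jk.
  exists v, j, m.+1; split=> //; first by lia.
  by rewrite descending_rcons (word_eval_rcons opA) // kE.
- exists (rcons v j.-1), k, m; split=> //.
    by rewrite all_rcons vn andbT; lia.
  rewrite (word_eval_rcons opA) // -opA; congr op.
  by apply: (descending_shift opA ope eop rels) => //; lia.
Qed.

Definition adj_swap (i k : nat) : nat :=
  if k == i then i.+1 else if k == i.+1 then i else k.

Definition word_action (w : seq nat) : nat -> nat := word_eval comp idfun adj_swap w.

Lemma adj_swap_spec i k : k = i /\ adj_swap i k = i.+1 \/
  k = i.+1 /\ adj_swap i k = i \/ k <> i /\ k <> i.+1 /\ adj_swap i k = k.
Proof. by rewrite /adj_swap; case: eqP => ?; [|case: eqP => ?]; tauto. Qed.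

Lemma adj_swapK i : involutive (adj_swap i).
Proof.
move=> k; rewrite /adj_swap; case: (eqVneq k i) => [->|ki].
  by rewrite eqxx eqn_leq ltnn.
case: (eqVneq k i.+1) => [->|ki']; first by rewrite eqxx.
by rewrite (negPf ki) (negPf ki').
Qed.

Lemma adj_swap_relations n : coxeter_relations comp idfun n adj_swap.
Proof.
split=> [i _|i _|i j ij _]; apply/funext => k /=.
- exact: adj_swapK.
- move: (adj_swap_spec i k) (adj_swap_spec i.+1 (adj_swap i k))
    (adj_swap_spec i (adj_swap i.+1 (adj_swap i k))) (adj_swap_spec i.+1 k)
    (adj_swap_spec i (adj_swap i.+1 k)) (adj_swap_spec i.+1 (adj_swap i (adj_swap i.+1 k))).
  by lia.
- move: (adj_swap_spec i k) (adj_swap_spec j (adj_swap i k))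
    (adj_swap_spec j k) (adj_swap_spec i (adj_swap j k)).
  by lia.
Qed.

Lemma word_action_fix n w k : all (fun i => i < n)%N w -> (n < k)%N -> word_action w k = k.
Proof.
move=> wn nk; elim: w wn => //= i w IH /andP[i_n /IH wE].
rewrite /word_action /= -/(word_action w k) wE /adj_swap.
rewrite !gtn_eqF // ?(ltn_trans i_n) // (leq_ltn_trans i_n) //.
Qed.

Lemma word_action_inj w : injective (word_action w).
Proof.
elim: w => //= i w IH a b; rewrite /word_action /= -/(word_action w a) -/(word_action w b).
by move=> /(inv_inj (@adj_swapK i)) /IH.
Qed.

Lemma word_action_surj w b : exists a, word_action w a = b.
Proof.
elim: w b => [|i w IH] b; first by exists b.
have [a aE] := IH (adj_swap i b); exists a.
by rewrite /word_action /= -/(word_action w a) aE adj_swapK.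
Qed.

Lemma word_action_descending k m : word_action (descending k m) k = (k + m)%N.
Proof.
elim: m => [|m IH]; first by rewrite addn0.
by rewrite /word_action /= -/(word_action _ _) IH /adj_swap eqxx addnS.
Qed.

(** Completeness of the Coxeter presentation, by induction on the number of generators: the
    permutation determines the coset part of the normal form, and the induction hypothesis settles
    the remaining word. *)
Theorem coxeter_word_eq (M : Type) (op : M -> M -> M) (e : M)
    (opA : forall x y z, op x (op y z) = op (op x y) z)
    (ope : forall x, op x e = x) (eop : forall x, op e x = x)
    (s : nat -> M) n (rels : coxeter_relations op e n s) w w' :
  all (fun i => i < n)%N w -> all (fun i => i < n)%N w' ->
  word_action w = word_action w' -> word_eval op e s w = word_eval op e s w'.
Proof.
elim: n rels w w' => [_ [|//] [|//]//|n IH] rels w w' wn wn' ww'.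
have [invol braid far] := rels.
have rels' : coxeter_relations op e n s.
  split=> [i i_n|i i_n|i j ij jn]; rewrite ?invol ?braid //; try exact: ltnW.
  by rewrite far // ltnW.
(* Normal forms for [s] and for the permutations are taken together, in a product. *)
pose op2 (x y : M * (nat -> nat)) := (op x.1 y.1, x.2 \o y.2).
pose s2 i := (s i, adj_swap i); pose e2 : M * (nat -> nat) := (e, idfun).
have op2A x y z : op2 x (op2 y z) = op2 (op2 x y) z by rewrite /op2 /= opA.
have op2e x : op2 x e2 = x by case: x => a b; rewrite /op2 /= ope.
have eop2 x : op2 e2 x = x by case: x => a b; rewrite /op2 /= eop.
have [invol' braid' far'] := adj_swap_relations n.+1.
have rels2 : coxeter_relations op2 e2 n.+1 s2.
  split=> [i i_n|i i_n|i j ij jn]; rewrite /op2 /=; congr pair;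
    by [exact: invol|exact: invol'|exact: braid|exact: braid'|exact: far|exact: far'].
have eval2 v : word_eval op2 e2 s2 v = (word_eval op e s v, word_action v).
  by elim: v => //= i v ->.
have [v [k [m [vn kmn]]]] := coxeter_normal_form op2A op2e eop2 rels2 wn.
have [v' [k' [m' [vn' kmn']]]] := coxeter_normal_form op2A op2e eop2 rels2 wn'.
rewrite !eval2 => -[-> w'a] [-> wa].
have vE : word_action v \o word_action (descending k m) =
    word_action v' \o word_action (descending k' m') by rewrite -wa -w'a.
(* [v] fixes [n + 1] and the descending word sends [k] there, so [k] is the preimage of [n + 1]
   under the whole word. *)
have kk' : k = k'.
  apply: (@word_action_inj w); rewrite [in RHS]ww' wa w'a /= !word_action_descending.
  by rewrite kmn kmn' !(@word_action_fix n).
have mm' : m = m' by apply: (@addnI k); rewrite kmn kk' kmn'.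
rewrite -kk' -mm' in vE *; congr op; apply: IH => //.
apply/funext => a; have [b <-] := word_action_surj (descending k m) a.
exact: (congr1 (fun f => f b) vE).
Qed.

(** * The permutation representation and the antisymmetrizer *)

Section PermutationRepresentation.
Context {R : realType} {T : symmetric_tensor_cstar_category R}.
Variable ρ : T.

Local Notation "A ⊠ B" := (ptens A B) (at level 39, left associativity).
Local Notation "A ⊚ B" := (pcomp A B) (at level 40, left associativity).
Local Notation I := (fun n => pid (ρ ^⊗ n)).

(** Packed endomorphisms of a tensor power: one predicate supplies all matching conditions of
    [pcomp] and hides the equality [tpowD]. *)
Definition pend n (A : @packed R T) := dom A = ρ ^⊗ n /\ cod A = ρ ^⊗ n.

Lemma pend_id n : pend n (I n). Proof. by []. Qed.

Lemma pend_tens m n A B : pend m A -> pend n B -> pend (m + n) (A ⊠ B).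
Proof. by case=> dA cA [dB cB]; rewrite /pend /= dA dB cA cB tpowD. Qed.

Lemma pend_comp n A B : pend n A -> pend n B -> pend n (A ⊚ B).
Proof. by case=> dA cA [dB cB]; rewrite /pend cod_pcomp dom_pcomp ?dA. Qed.

Lemma pend1l n A : pend n A -> I n ⊚ A = A. Proof. by case=> _ /pcomp1l. Qed.
Lemma pend1r n A : pend n A -> A ⊚ I n = A. Proof. by case=> /pcomp1r. Qed.

Lemma pendA n A B C : pend n A -> pend n B -> pend n C -> A ⊚ (B ⊚ C) = (A ⊚ B) ⊚ C.
Proof. by case=> dA cA [dB cB] [dC cC]; rewrite pcompA // ?dA ?dB. Qed.

Lemma pend_interchange m n A B A' B' :
  pend m A -> pend m B -> pend n A' -> pend n B' ->
  (A ⊚ B) ⊠ (A' ⊚ B') = (A ⊠ A') ⊚ (B ⊠ B').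
Proof.
by case=> dA cA [dB cB] [dA' cA'] [dB' cB']; rewrite ptens_pcomp ?dA ?dA'.
Qed.

Lemma pid_tpowD m n : I (m + n)%N = I m ⊠ I n.
Proof. by rewrite -pid_tob tpowD. Qed.

Lemma pend_slide m n A B : pend m A -> pend n B ->
  (A ⊠ I n) ⊚ (I m ⊠ B) = (I m ⊠ B) ⊚ (A ⊠ I n).
Proof.
move=> mA nB; rewrite -(pend_interchange mA (pend_id m) (pend_id n) nB).
rewrite -(pend_interchange (pend_id m) mA nB (pend_id n)).
by rewrite (pend1l mA) (pend1r mA) (pend1l nB) (pend1r nB).
Qed.

Let E := pack (symmetry ρ ρ).

Lemma pend_symmetry : pend 2 E.
Proof. by rewrite /pend /= tob1r. Qed.

Lemma symmetry_involutive : E ⊚ E = I 2.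
Proof. by rewrite -pack_comp symK /= tob1r. Qed.

(** Naturality of ε(ρρ,ρ) at ε(ρ,ρ) ⊗ 1, with ε(ρρ,ρ) expanded by the hexagon on both sides. *)
Lemma yang_baxter : (E ⊠ I 1) ⊚ ((I 1 ⊠ E) ⊚ (E ⊠ I 1)) =
  (I 1 ⊠ E) ⊚ ((E ⊠ I 1) ⊚ (I 1 ⊠ E)).
Proof.
have e1 : pend 3 (E ⊠ I 1) := pend_tens pend_symmetry (pend_id 1).
have e2 : pend 3 (I 1 ⊠ E) := pend_tens (pend_id 1) pend_symmetry.
have := congr1 (@pack _ _ _ _) (sym_natural (symmetry ρ ρ) (idn ρ)).
rewrite !pack_comp sym_hexagon pack_comp !pack_hcast !pack_tens.
by rewrite -/(pid ρ) -(tpow1 ρ) tpow1 -/E -[in pid _](tpow1 ρ) (pendA e1 e2 e1).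
Qed.

Variable r : nat.

(** Indexed by [nat] to fit [coxeter_relations]; the identity is a default value outside the
    range. *)
Definition generator (k : nat) : arrow (ρ ^⊗ r) (ρ ^⊗ r) :=
  if insub k is Some i then adj_generator ρ i else idn _.

Lemma pack_generator k : (k.+1 < r)%N ->
  pack (generator k) = I k ⊠ (E ⊠ I (r - k.+2)%N).
Proof.
move=> kr; have kr' : (k < r.-1)%N by lia.
by rewrite /generator insubT /adj_generator pack_hcast.
Qed.

Lemma generator_relations : coxeter_relations compose (idn (ρ ^⊗ r)) r.-1 generator.
Proof.
split=> [i ir|i ir|i j ij jr]; apply: pack_inj; rewrite !pack_comp !pack_generator; try lia.
- have eE : pend (2 + (r - i.+2))%N (E ⊠ I (r - i.+2)%N).
    exact: pend_tens pend_symmetry (pend_id _).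
  rewrite -(pend_interchange (pend_id i) (pend_id i) eE eE).
  rewrite -(pend_interchange pend_symmetry pend_symmetry (pend_id _) (pend_id _)).
  rewrite symmetry_involutive !(pend1l (pend_id _)) -!pid_tpowD.
  by congr pid; congr tpow; lia.
(* Splitting one strand off the right identity puts both generators on the same three strands, where
   [yang_baxter] applies. *)
- set k := (r - i.+3)%N.
  have -> : (r - i.+2 = 1 + k)%N by lia.
  have -> : i.+1 = (i + 1)%N by lia.
  rewrite !pid_tpowD -!ptensA.
  have e1 : pend 3 (E ⊠ I 1) := pend_tens pend_symmetry (pend_id 1).
  have e2 : pend 3 (I 1 ⊠ E) := pend_tens (pend_id 1) pend_symmetry.
  have e0 (A B : packed) : pend 3 A -> pend 3 B ->
      (I i ⊠ (A ⊠ I k)) ⊚ (I i ⊠ (B ⊠ I k)) = I i ⊠ ((A ⊚ B) ⊠ I k).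
    move=> eA eB; have ek := pend_id k.
    rewrite -(pend_interchange (pend_id i) (pend_id i) (pend_tens eA ek) (pend_tens eB ek)).
    by rewrite -(pend_interchange eA eB ek ek) !(pend1l (pend_id _)).
  rewrite (ptensA E) (ptensA (I 1) E) !e0 ?yang_baxter //; exact: pend_comp.
(* The generator [i] lives on the first [j] strands and the generator [j] on the others, so they
   slide past each other. *)
- have jE : (j = i + (2 + (j - i.+2)))%N by lia.
  have rE : (r - i.+2 = (j - i.+2) + (2 + (r - j.+2)))%N by lia.
  have eA : pend j (I i ⊠ (E ⊠ I (j - i.+2)%N)).
    rewrite [X in pend X _]jE.
    exact: pend_tens (pend_id _) (pend_tens pend_symmetry (pend_id _)).
  have eB : pend (2 + (r - j.+2))%N (E ⊠ I (r - j.+2)%N).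
    exact: pend_tens pend_symmetry (pend_id _).
  have -> : I i ⊠ (E ⊠ I (r - i.+2)%N) =
      (I i ⊠ (E ⊠ I (j - i.+2)%N)) ⊠ I (2 + (r - j.+2))%N.
    by rewrite rE pid_tpowD !ptensA.
  exact: pend_slide.
Qed.

Lemma word_arrow_eval (w : seq 'I_r.-1) :
  word_arrow ρ w = word_eval compose (idn _) generator (map val w).
Proof. by elim: w => //= i w ->; rewrite /generator valK. Qed.

Lemma word_perm_action (w : seq 'I_r.-1) (k : 'I_r) :
  word_perm w k = word_action (map val w) k :> nat.
Proof.
elim: w => [|i w IH] /=; first by rewrite perm1.
rewrite /word_action /= -/(word_action _ k) -IH permM /adj_transposition /adj_swap.
case: tpermP => [->|->|/eqP k1 /eqP k2] /=; first by rewrite eqxx.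
  by rewrite eqxx eqn_leq ltnn.
by move: k1 k2; rewrite -!val_eqE /= => /negPf -> /negPf ->.
Qed.

(** This makes [perm_arrow] independent of the word chosen for a permutation. *)
Lemma word_arrow_perm (w w' : seq 'I_r.-1) :
  word_perm w = word_perm w' -> word_arrow ρ w = word_arrow ρ w'.
Proof.
move=> ww'; have small (v : seq 'I_r.-1) : all (fun i => i < r.-1)%N (map val v).
  by apply/allP => _ /mapP[i _ ->]; rewrite /= ltn_ord.
rewrite !word_arrow_eval; apply: (coxeter_word_eq _ _ _ generator_relations) => //.
- by move=> x y z; rewrite compA.
- exact: compid.
- exact: idcomp.
apply/funext => k; have [kr|rk] := ltnP k r.
  by rewrite -!(word_perm_action _ (Ordinal kr)) ww'.
(* For [r = 0] the bound of [word_action_fix] misses the point 0, but words over ['I_0] are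
   empty. *)
case: r w w' ww' small rk => [|r'] w w' ww' small rk; last by rewrite !(word_action_fix (small _)).
by case: w w' {ww'} => [|[]] // [|[]].
Qed.

Lemma perm_arrow_mul (p q : 'S_r) : perm_arrow ρ p ∘ perm_arrow ρ q = perm_arrow ρ (q * p).
Proof.
rewrite /perm_arrow; set wp := xchoose _; set wq := xchoose _; set w := xchoose _.
have -> : word_arrow ρ wp ∘ word_arrow ρ wq = word_arrow ρ (wp ++ wq).
  rewrite !word_arrow_eval map_cat word_eval_cat //.
    by move=> x y z; rewrite compA.
  exact: idcomp.
apply: word_arrow_perm; rewrite word_perm_cat.
by rewrite (eqP (xchooseP (word_perm_surj q))) (eqP (xchooseP (word_perm_surj p)))
  (eqP (xchooseP (word_perm_surj (q * p)%g))).
Qed.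

(** Each signed permutation arrow fixes the signed sum [S] on the left, by reindexing, so that
    [S ∘ S] is [r!] times [S]. *)
Lemma antisymmetrizer_idempotent :
  antisymmetrizer ρ r ∘ antisymmetrizer ρ r = antisymmetrizer ρ r.
Proof.
rewrite /antisymmetrizer; set S := \sum_p _.
suff SS : S ∘ S = (r`!%:R : R[i]) *: S.
  rewrite compZl compZr SS !scalerA -mulrA mulVf ?mulr1 //.
  by rewrite pnatr_eq0 -lt0n fact_gt0.
rewrite {1}/S comp_suml.
rewrite (eq_bigr (fun=> S)) => [|p _]; first by rewrite sumr_const card_Sn scaler_nat.
rewrite /S comp_sumr [RHS](reindex_inj (mulIg p)) /=; apply: eq_bigr => q _.
by rewrite compZl compZr perm_arrow_mul scalerA odd_permM signr_addb [_ ^+ q * _]mulrC.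
Qed.

End PermutationRepresentation.

(** * Characters and fibre norms *)

Section Characters.
Context {R : realType} {T : symmetric_tensor_cstar_category R}.
Implicit Types (f g h a : arrow (ι : T) ι).

Lemma centre_pred_full f : f \in centre_pred.
Proof. by apply/asboolP; exact: unit_central. Qed.

Definition to_centre f : centre T := Centre (centre_pred_full f).

Lemma to_centreK (f : centre T) : to_centre f = f.
Proof. exact: val_inj. Qed.

Variable x : character T.

(** By [unit_central], [centre T] is all of (ι,ι); [chi] evaluates the character there without the
    subtype. *)
Definition chi f : R[i] := x (to_centre f).

Lemma chiE (f : centre T) : x f = chi f.
Proof. by rewrite /chi to_centreK. Qed.

Lemma chi_linear c f g : chi (c *: f + g) = c * chi f + chi g.
Proof. by rewrite /chi -[_ * _ + _](linearP x c); congr (x _); apply: val_inj. Qed.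

Lemma chi1 : chi (idn ι) = 1.
Proof. by rewrite -(character1 x) /chi; congr (x _); apply: val_inj. Qed.

Lemma chiM f g : chi (f ∘ g) = chi f * chi g.
Proof. by rewrite /chi -characterM; congr (x _); apply: val_inj. Qed.

Lemma chi0 : chi 0 = 0.
Proof.
have := chi_linear 1 0 0; rewrite scaler0 addr0 mul1r => /eqP.
by rewrite -subr_eq0 opprD addrA subrr sub0r oppr_eq0 => /eqP.
Qed.

Lemma chiD f g : chi (f + g) = chi f + chi g.
Proof. by have := chi_linear 1 f g; rewrite scale1r mul1r. Qed.

Lemma chiZ c f : chi (c *: f) = c * chi f.
Proof. by have := chi_linear c f 0; rewrite chi0 !addr0. Qed.

Lemma chiN f : chi (- f) = - chi f.
Proof. by rewrite -scaleN1r chiZ mulN1r. Qed.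

Lemma chiB f g : chi (f - g) = chi f - chi g.
Proof. by rewrite chiD chiN. Qed.

Lemma chi_sum (I : Type) (r : seq I) (P : pred I) (F : I -> arrow (ι : T) ι) :
  chi (\sum_(i <- r | P i) F i) = \sum_(i <- r | P i) chi (F i).
Proof. by apply: (big_morph chi) => [f g|]; rewrite ?chiD ?chi0. Qed.

(* If [|x f| > |f|], then [h = f / x f] has norm less than one, so [1 - h] is invertible,
   although its value at [x] is zero. *)
Lemma cabs_chi f : cabs (chi f) <= nrm f.
Proof.
rewrite leNgt; apply/negP => f_lt.
have z0 : chi f != 0.
  by apply: contraTneq f_lt => ->; rewrite cabs0 -leNgt nrm_ge0.
pose h := (chi f)^-1 *: f.
have h1 : nrm h < 1.
  rewrite /h nrmZ -(@ltr_pM2l _ (cabs (chi f))).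
    by rewrite mulrA -cabsM mulfV // cabs1 mul1r mulr1.
  by rewrite (le_lt_trans (nrm_ge0 f)).
have [||u v _ _||g _ gE] :=
  @contraction_fixed _ _ setT (fun g => idn ι + h ∘ g) _ 0 (nrm_ge0 h) h1.
- by [].
- by [].
- by rewrite opprD addrACA subrr add0r -compBr nrm_comp.
- by [].
move: (congr1 chi gE); rewrite chiD chi1 chiM chiZ mulVf // mul1r => /eqP.
by rewrite -[X in _ == X]add0r (inj_eq (addIr _)) oner_eq0.
Qed.

(** Arens' trick: for real [l], the value at [a + i l] is bounded by its norm, whose square is at
    most [|a|^2 + l^2], while the square of the value contains the cross term [2 l Im (chi a)]. *)
Lemma chi_self_adjoint a : a^† = a -> complex.Im (chi a) = 0.
Proof.
move=> aa; set z := chi a.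
have bound (l : R) : complex.Re z ^+ 2 + (complex.Im z + l) ^+ 2 <= nrm a ^+ 2 + l ^+ 2.
  pose b := a + (l%:C * imag) *: idn ι.
  have bS : b^† = a - (l%:C * imag) *: idn ι.
    rewrite /b starD starZ aa star_id -scaleNr; congr (_ + _ *: _).
    by apply/eqP; rewrite eq_complex /imag /=; apply/andP; split; apply/eqP; ring.
  have -> : complex.Re z ^+ 2 + (complex.Im z + l) ^+ 2 = cabs (chi b) ^+ 2.
    rewrite sqr_cabs /b chiD chiZ chi1 -/z; case: (z) => re im /=; ring.
  rewrite (@le_trans _ _ (nrm b ^+ 2)) //.
    by rewrite lerXn2r ?nnegrE ?nrm_ge0 ?cabs_ge0 // cabs_chi.
  rewrite -nrm_cstar bS /b !(compDl, compDr, compNl, compZl, compZr) !compid !idcomp.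
  have -> t : (t + (l%:C * imag) *: a + (- ((l%:C * imag) *: a)
      - (l%:C * imag) *: ((l%:C * imag) *: idn ι)) : arrow ι ι) = t + (l ^+ 2)%:C *: idn ι.
    rewrite addrA addrK scalerA -scaleNr; congr (_ + _ *: _).
    by apply/eqP; rewrite eq_complex /imag /=; apply/andP; split; apply/eqP; ring.
  rewrite (le_trans (nrmD _ _)) // lerD //; first by rewrite expr2 nrm_comp.
  rewrite nrmZ cabs_real ger0_norm ?sqr_ge0 // -[leRHS]mulr1 ler_wpM2l ?sqr_ge0 //.
  exact: nrm_idn.
have [//|im0] := eqVneq (complex.Im z) 0.
(* This [l] makes the cross term equal to [|a|^2 + 1], which exceeds the bound. *)
pose im := complex.Im z; have := bound ((nrm a ^+ 2 + 1) / (2 * im)).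
rewrite -/im.
have im0' : im != 0 by [].
have -> : (im + (nrm a ^+ 2 + 1) / (2 * im)) ^+ 2 =
    im ^+ 2 + (nrm a ^+ 2 + 1) + ((nrm a ^+ 2 + 1) / (2 * im)) ^+ 2 by field.
have := sqr_ge0 im; have := sqr_ge0 (complex.Re z).
set u := _ / _; lra.
Qed.

Definition re_part f : arrow (ι : T) ι := (2^-1 : R)%:C *: (f + f^†).
Definition im_part f : arrow (ι : T) ι := ((2^-1 : R)%:C * - imag) *: (f - f^†).

Lemma re_part_self_adjoint f : (re_part f)^† = re_part f.
Proof. by rewrite /re_part starZ_real starD starK addrC. Qed.

Lemma im_part_self_adjoint f : (im_part f)^† = im_part f.
Proof.
rewrite /im_part starZ starB starK -[f^† - f]opprB scalerN -scaleNr; congr (_ *: _).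
by apply/eqP; rewrite eq_complex /imag /=; apply/andP; split; apply/eqP; ring.
Qed.

Lemma re_im_part f : f = re_part f + imag *: im_part f.
Proof.
rewrite /re_part /im_part scalerA.
have -> : imag * ((2^-1)%:C * - imag) = (2^-1 : R)%:C.
  by apply/eqP; rewrite eq_complex /imag /=; apply/andP; split; apply/eqP; ring.
by rewrite -scalerDr addrACA subrr addr0 scalerDr scale_halfD.
Qed.

Lemma re_im_part_star f : f^† = re_part f - imag *: im_part f.
Proof.
rewrite [in LHS](re_im_part f) starD starZ re_part_self_adjoint im_part_self_adjoint.
rewrite -scaleNr; congr (_ + _ *: _).
by apply/eqP; rewrite eq_complex /imag /= oppr0 !eqxx.
Qed.

Lemma chi_star f : chi (f^†) = ((chi f)^*)%C.
Proof.
rewrite re_im_part_star [in RHS](re_im_part f) chiB chiD !(chiZ imag).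
move: (chi_self_adjoint (re_part_self_adjoint f)).
move: (chi_self_adjoint (im_part_self_adjoint f)).
move: (chi (re_part f)) (chi (im_part f)) => [a b] [c d] /= -> ->.
by apply/eqP; rewrite eq_complex /imag /=; apply/andP; split; apply/eqP; ring.
Qed.

Lemma chi_parts0 f : chi f = 0 -> chi (re_part f) = 0 /\ chi (im_part f) = 0.
Proof.
by move=> f0; rewrite /re_part /im_part !chiZ chiD chiB chi_star f0 rmorph0 subrr addr0 !mulr0.
Qed.

End Characters.

(** * Fibre norms through peak functions *)

Section FibreNorm.
Context {R : realType} {T : symmetric_tensor_cstar_category R}.
Variable x : character T.
Implicit Types (ρ σ τ : T) (f g h a : arrow (ι : T) ι).

Definition peak g := nrm g <= 1 /\ chi x g = 1.

Lemma peak_id : peak (idn ι).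
Proof. by split; [exact: nrm_idn|exact: chi1]. Qed.

Lemma peak_comp g h : peak g -> peak h -> peak (g ∘ h).
Proof.
move=> [g1 gx] [h1 hx]; split; last by rewrite chiM gx hx mulr1.
by rewrite (le_trans (nrm_comp _ _)) // mulr_ile1 ?nrm_ge0.
Qed.

Lemma peak_star g : peak g -> peak (g^†).
Proof. by move=> [g1 gx]; split; rewrite ?nrm_star // chi_star gx rmorph1. Qed.

Definition local_norm ρ σ (t : arrow ρ σ) : R := inf [set nrm (lact g t) | g in peak].

Lemma local_norm_has_inf ρ σ (t : arrow ρ σ) : has_inf [set nrm (lact g t) | g in peak].
Proof.
split; first by exists (nrm (lact (idn ι) t)), (idn ι) => //; exact: peak_id.
by exists 0 => _ [g _ <-]; exact: nrm_ge0.
Qed.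

Lemma local_norm_le ρ σ (t : arrow ρ σ) g : peak g -> local_norm t <= nrm (lact g t).
Proof. by move=> pg; apply: ge_inf; [have [] := local_norm_has_inf t|exists g]. Qed.

Lemma le_local_norm ρ σ (t : arrow ρ σ) (c : R) :
  (forall g, peak g -> c <= nrm (lact g t)) -> c <= local_norm t.
Proof.
move=> c_le; apply: lb_le_inf; first by have [] := local_norm_has_inf t.
by move=> _ [g pg <-]; exact: c_le.
Qed.

Lemma local_norm_ge0 ρ σ (t : arrow ρ σ) : 0 <= local_norm t.
Proof. by apply: le_local_norm => g _; exact: nrm_ge0. Qed.

Lemma local_norm_nrm ρ σ (t : arrow ρ σ) : local_norm t <= nrm t.
Proof. by rewrite (le_trans (local_norm_le _ peak_id)) // lact1. Qed.

Lemma local_norm_approx ρ σ (t : arrow ρ σ) (e : R) : 0 < e ->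
  exists2 g, peak g & nrm (lact g t) < local_norm t + e.
Proof.
move=> e0; have [_ [g pg <-] gE] := inf_adherent e0 (local_norm_has_inf t).
by exists g.
Qed.

Lemma nrm_lact_peak ρ σ (t : arrow ρ σ) g h : nrm g <= 1 ->
  nrm (lact (g ∘ h) t) <= nrm (lact h t).
Proof.
move=> g1; rewrite -lact_lact (le_trans (nrm_lact _ _)) //.
by rewrite ler_piMl // nrm_ge0.
Qed.

(** Transfers norm bounds to fibres: an operation commuting with the action of (ι,ι) keeps its
    bound, with the same constant at every point. *)
Lemma local_norm_mono ρ σ ρ' σ' (t : arrow ρ σ) (s : arrow ρ' σ') (K : R) : 0 <= K ->
  (forall g, nrm (lact g t) <= K * nrm (lact g s)) ->
  local_norm t <= K * local_norm s.
Proof.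
move=> K0 ts; have [Kz|Kn0] := eqVneq K 0.
  rewrite Kz mul0r in ts *.
  by rewrite (le_trans (local_norm_le _ peak_id)) // (le_trans (ts _)) // mul0r.
have K0' : 0 < K by rewrite lt_def Kn0.
rewrite mulrC -ler_pdivrMr //; apply: le_local_norm => g pg.
by rewrite ler_pdivrMr // mulrC (le_trans (local_norm_le _ pg)).
Qed.

(** Near-optimal peaks for [t] and [s] are merged by composition, since a further factor from the
    unit ball does not increase the norm. *)
Lemma local_normD ρ σ (t s : arrow ρ σ) : local_norm (t + s) <= local_norm t + local_norm s.
Proof.
apply/ler_addgt0Pr => e e0; have e2 : 0 < e / 2 by rewrite divr_gt0.
have [g pg gt] := local_norm_approx t e2; have [h ph hs] := local_norm_approx s e2.
rewrite (le_trans (local_norm_le _ (peak_comp pg ph))) // lactDr.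
rewrite (le_trans (nrmD _ _)) // [in leRHS](splitr e) addrACA lerD //.
  by rewrite unit_compC (le_trans (nrm_lact_peak _ _ ph.1)) // ltW.
by rewrite (le_trans (nrm_lact_peak _ _ pg.1)) // ltW.
Qed.

Lemma local_norm0 ρ σ : local_norm (0 : arrow ρ σ) = 0.
Proof.
apply/eqP; rewrite eq_le local_norm_ge0 andbT.
by rewrite (le_trans (local_norm_nrm _)) // nrm0.
Qed.

Lemma local_norm_sum ρ σ (I : Type) (r : seq I) (P : pred I) (F : I -> arrow ρ σ) :
  local_norm (\sum_(i <- r | P i) F i) <= \sum_(i <- r | P i) local_norm (F i).
Proof.
elim/big_ind2 : _ => //; first by rewrite local_norm0.
by move=> a b c d ab cd; rewrite (le_trans (local_normD _ _)) // lerD.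
Qed.

Lemma local_normZ ρ σ c (t : arrow ρ σ) : local_norm (c *: t) <= cabs c * local_norm t.
Proof. by apply: local_norm_mono => [|g]; rewrite ?cabs_ge0 // lactZr nrmZ. Qed.

Lemma local_norm_comp_le_l ρ σ τ (t : arrow σ τ) (s : arrow ρ σ) :
  local_norm (t ∘ s) <= nrm t * local_norm s.
Proof.
by apply: local_norm_mono => [|g]; rewrite ?nrm_ge0 // lact_compr nrm_comp.
Qed.

Lemma local_norm_comp_le_r ρ σ τ (t : arrow σ τ) (s : arrow ρ σ) :
  local_norm (t ∘ s) <= nrm s * local_norm t.
Proof.
by apply: local_norm_mono => [|g]; rewrite ?nrm_ge0 // lact_compl mulrC nrm_comp.
Qed.

Lemma local_norm_tens_idl ρ σ τ (t : arrow ρ σ) : local_norm (idn τ ⊗ t) <= local_norm t.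
Proof.
rewrite -[leRHS]mul1r; apply: local_norm_mono => // g.
by rewrite mul1r lact_tensr nrm_tens_idl.
Qed.

Lemma local_norm_hcast ρ ρ' σ σ' (e : ρ = ρ') (e' : σ = σ') (t : arrow ρ σ) :
  local_norm (hcast e e' t) = local_norm t.
Proof. by case: _ / e; case: _ / e'. Qed.

Lemma local_norm_lact ρ σ f (t : arrow ρ σ) : local_norm (lact f t) <= nrm t * local_norm f.
Proof.
apply: local_norm_mono => [|g]; first exact: nrm_ge0.
by rewrite lact_lact mulrC lact_unit nrm_lact.
Qed.

(** The square of the norm of [g t] is the norm of [(g^† ∘ g) (t^† ∘ t)]. One inequality holds
    because [g^† ∘ g] is again a peak, the other because dropping [g^†] can only increase the
    norm. *)
Lemma local_norm_cstar ρ σ (t : arrow ρ σ) : local_norm (t^† ∘ t) = local_norm t ^+ 2.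
Proof.
have lactE g : nrm (lact g t) ^+ 2 = nrm (lact (g^† ∘ g) (t^† ∘ t)).
  by rewrite -nrm_cstar lact_star lact_comp.
apply/eqP; rewrite eq_le; apply/andP; split.
  rewrite -ler_sqrt ?sqr_ge0 // sqrtr_sqr ger0_norm ?local_norm_ge0 //.
  apply: le_local_norm => g pg.
  rewrite -[leRHS]ger0_norm ?nrm_ge0 // -sqrtr_sqr ler_sqrt ?sqr_ge0 // lactE.
  exact: local_norm_le (peak_comp (peak_star pg) pg).
apply: le_local_norm => g pg.
rewrite (@le_trans _ _ (nrm (lact g t) ^+ 2)) //.
  by rewrite lerXn2r ?nnegrE ?nrm_ge0 ?local_norm_ge0 // local_norm_le.
by rewrite lactE nrm_lact_peak // nrm_star; have [] := pg.
Qed.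

(* With [p = 1 - a^2] and [g] the average of [1, p, ..., p^(n-1)], the product
   [n g a^2 = 1 - p^n] is bounded. *)
Lemma local_norm_self_adjoint0 a : a^† = a -> nrm a < 1 -> chi x a = 0 -> local_norm a = 0.
Proof.
move=> aa a1 xa; pose p := idn ι - a ∘ a.
have pp : peak p.
  by split; [exact: nrm_one_sub_sqr|rewrite chiB chiM xa chi1 mulr0 subr0].
pose q n := iter n (compose p) (idn ι).
have pq n : peak (q n).
  by elim: n => [|n IH] /=; [exact: peak_id|exact: peak_comp].
have tele n : (\sum_(i < n) q i) ∘ (a ∘ a) = idn ι - q n.
  elim: n => [|n IH]; first by rewrite big_ord0 comp0l /= subrr.
  rewrite big_ord_recr /= compDl IH unit_compC.
  have -> : a ∘ a ∘ q n = q n - p ∘ q n by rewrite /p compBl idcomp subKr.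
  by rewrite addrA subrK.
have small n : local_norm a ^+ 2 <= 2 / n.+1%:R.
  have n0 : (n.+1%:R : R) != 0 by rewrite pnatr_eq0.
  pose g := (n.+1%:R^-1 : R)%:C *: \sum_(i < n.+1) q i.
  have pg : peak g.
    split.
      rewrite /g nrmZ cabs_real ger0_norm ?invr_ge0 // ler_pdivrMl // mulr1.
      rewrite (le_trans (nrm_sum _ _ _)) // -[n.+1 in leRHS]card_ord -sumr_const.
      by apply: ler_sum => i _; have [] := pq i.
    rewrite /g chiZ chi_sum (eq_bigr (fun=> 1)) => [|i _]; last by have [] := pq i.
    rewrite sumr_const card_ord -(rmorph_nat (real_complex R)) -rmorphM /=.
    by rewrite mulVf.
  rewrite (@le_trans _ _ (nrm (lact g a) ^+ 2)) //.
    by rewrite lerXn2r ?nnegrE ?nrm_ge0 ?local_norm_ge0 // local_norm_le.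
  rewrite -nrm_cstar lact_star aa lact_comp.
  rewrite (le_trans (nrm_lact_peak _ _ _)) ?nrm_star //; first by case: pg.
  rewrite lact_unit /g compZl tele nrmZ cabs_real ger0_norm ?invr_ge0 // mulrC.
  rewrite ler_wpM2r ?invr_ge0 // (le_trans (nrmB _ _)) // [2]mulr2n lerD ?nrm_idn //.
  by have [] := pq n.+1.
have [//|a0] := eqVneq (local_norm a) 0.
have a2 : 0 < local_norm a ^+ 2 by rewrite exprn_gt0 // lt_def a0 local_norm_ge0.
have := small (Num.truncn (2 / local_norm a ^+ 2)).
rewrite ler_pdivlMr ?ltr0n // mulrC -ler_pdivlMr // leNgt.
by rewrite truncnS_gt.
Qed.

Lemma local_norm_chi0 f : chi x f = 0 -> local_norm f = 0.
Proof.
move=> xf.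
have self_adjoint a : a^† = a -> chi x a = 0 -> local_norm a = 0.
  move=> aa xa; pose c : R := (nrm a + 1)^-1.
  have a1 : 0 < nrm a + 1 by rewrite ltr_wpDl ?nrm_ge0.
  have c0 : 0 < c by rewrite invr_gt0.
  have ca : local_norm (c%:C *: a) = 0.
    apply: local_norm_self_adjoint0; rewrite ?starZ_real ?aa ?chiZ ?xa ?mulr0 //.
    by rewrite nrmZ cabs_real ger0_norm ?ltW // mulrC ltr_pdivrMr // mul1r ltrDl.
  apply/eqP; rewrite eq_le local_norm_ge0 andbT.
  have -> : a = (c^-1)%:C *: (c%:C *: a).
    by rewrite scalerA -rmorphM /= mulVf ?scale1r // gt_eqF.
  by rewrite (le_trans (local_normZ _ _)) // ca mulr0.
have [re0 im0] := chi_parts0 xf.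
apply/eqP; rewrite eq_le local_norm_ge0 andbT (re_im_part f) (le_trans (local_normD _ _)) //.
rewrite self_adjoint ?re_part_self_adjoint // add0r (le_trans (local_normZ _ _)) //.
by rewrite self_adjoint ?im_part_self_adjoint // mulr0.
Qed.

(** Subtracting the constant [chi x f] leaves a function vanishing at [x], of local norm zero. *)
Lemma local_norm_unit f : local_norm f = cabs (chi x f).
Proof.
apply/eqP; rewrite eq_le; apply/andP; split; last first.
  apply: le_local_norm => g [_ gx].
  by rewrite lact_unit (le_trans _ (cabs_chi x _)) // chiM gx mul1r.
rewrite -[f in leLHS](subrK (chi x f *: idn ι)) (le_trans (local_normD _ _)) //.
rewrite local_norm_chi0 ?add0r; last by rewrite chiB chiZ chi1 mulr1 subrr.
rewrite (le_trans (local_norm_nrm _)) // nrmZ -[leRHS]mulr1 ler_wpM2l ?cabs_ge0 //.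
exact: nrm_idn.
Qed.

End FibreNorm.

Section FibreNormE.
Context {R : realType} {T : symmetric_tensor_cstar_category R}.
Variable x : spectrum T.
Variables ρ σ : T.

(** The null space of the seminorm [local_norm] is a closed subspace containing the generators of
    [vanishing_part]. *)
Lemma vanishing_local_norm0 (t : arrow ρ σ) :
  vanishing_part x t -> local_norm (x : character T) t = 0.
Proof.
move=> /(_ [set s | local_norm (x : character T) s = 0]); apply; split; last first.
  move=> _ [f /= xf [s _ <-]]; apply/eqP; rewrite eq_le local_norm_ge0 andbT.
  by rewrite (le_trans (local_norm_lact _ _ _)) // local_norm_chi0 -?chiE // mulr0.
split; first split.
- exact: local_norm0.
- move=> a u v /= u0 v0; apply/eqP; rewrite eq_le local_norm_ge0 andbT.
  rewrite (le_trans (local_normD _ _ _)) // v0 addr0.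
  by rewrite (le_trans (local_normZ _ _ _)) // u0 mulr0.
move=> u clu /=; apply/eqP; rewrite eq_le local_norm_ge0 andbT.
apply/ler_addgt0Pr => e e0; rewrite add0r.
have e0' : 0 < e%:C by rewrite ltcR.
have [v [/= v0]] := clu _ (nbhsx_ballx u _ e0').
rewrite -ball_normE /= norm_nrm ltcR => uv.
rewrite -(subrK v u) (le_trans (local_normD _ _ _)) // v0 addr0.
by rewrite (le_trans (local_norm_nrm _ _)) // ltW.
Qed.

(** For a peak [g], [lact g t] represents the class of [t], as [g - 1] vanishes at [x]. Conversely,
    any representative has the local norm of [t], which is at most its norm. *)
Lemma fibre_normE (t : arrow ρ σ) :
  fibre_norm (fibre_proj x t) = local_norm (x : character T) t.
Proof.
have projE (s : arrow ρ σ) : fibre_proj x s = fibre_proj x t <-> vanishing_part x (s - t).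
  rewrite /fibre_proj; split=> [/eqP|st].
    by rewrite -Quotient.idealrBE => /asboolP.
  by apply/eqP; rewrite -Quotient.idealrBE; apply/asboolP.
have bdd : has_lbound [set complex.Re `|s|
    | s in [set s : arrow ρ σ | fibre_proj x s = fibre_proj x t]].
  by exists 0 => _ [s _ <-]; exact: nrm_ge0.
apply/eqP; rewrite eq_le; apply/andP; split.
  apply: le_local_norm => g [_ gx]; apply: ge_inf => //.
  exists (lact g t) => //=; apply/projE => B [_ gen]; apply: gen => /=.
  exists (to_centre (g - idn ι)); first by rewrite /= -/(chi _ _) chiB gx chi1 subrr.
  by exists t => //; rewrite /= lactBl lact1.
apply: lb_le_inf; first by exists (nrm t), t.
move=> _ [s /= /projE /vanishing_local_norm0 st <-].
rewrite -/(nrm s) [in leLHS](_ : t = (-1) *: (s - t) + s); last first.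
  by rewrite scaleN1r opprB subrK.
rewrite (le_trans (local_normD _ _ _)) // (le_trans _ (local_norm_nrm x s)) //.
by rewrite gerDr (le_trans (local_normZ _ _ _)) // st mulr0.
Qed.

End FibreNormE.

(** * Uniform bounds and continuity *)

Section Tame.
Context {R : realType} {T : symmetric_tensor_cstar_category R}.
Implicit Types (ρ σ τ κ : T) (x : spectrum T).

Local Notation N x t := (local_norm (x : character T) t).

Lemma cabs_dist (z w : R[i]) : `|cabs z - cabs w| <= cabs (z - w).
Proof.
have := ler_dist_dist z w; rewrite (normC_cabs z) (normC_cabs w) -rmorphB /=.
by rewrite (normC_cabs _%:C) (normC_cabs (z - w)) cabs_real lecR.
Qed.

Lemma cabs_chi_continuous (f : arrow (ι : T) ι) :
  continuous (fun x : spectrum T => cabs (chi (x : character T) f)).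
Proof.
move=> x; have ? : Filter (nbhs x) by exact: nbhs_filter.
apply/cvgrPdist_lt => e e0.
have cont : continuous (fun y : spectrum T => chi (y : character T) f : R[i]^o).
  move=> y; apply: (@continuous_comp _ _ _
    (fun y : spectrum T => (y : character T) : {ptws centre T -> R[i]^o})
    (fun h : {ptws centre T -> R[i]^o} => h (to_centre f))).
    exact: initial_continuous.
  exact: (@proj_continuous _ (fun=> R[i]^o)).
move/cvgrPdist_lt : (cont x) => /(_ e%:C); rewrite ltcR => /(_ e0).
apply: filterS => y; rewrite normC_cabs ltcR; apply: le_lt_trans.
exact: cabs_dist.
Qed.

(* The fibre norms of [t] are equivalent to a continuous function, with a constant that
   depends neither on the point nor on [t]. *)
Definition tame_hom κ τ : Prop :=
  exists (Φ : arrow κ τ -> spectrum T -> R) (C : R), 0 < C /\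
    forall t, continuous (Φ t) /\ forall x, N x t <= C * Φ t x /\ Φ t x <= C * N x t.

Definition tame κ : Prop := forall τ, tame_hom κ τ.

Lemma tame_unit : tame ι.
Proof.
move=> τ; exists (fun t x => Num.sqrt (cabs (chi (x : character T) (t^† ∘ t)))), 1.
split=> // t; split=> [x|x].
  apply: (@continuous_comp _ _ _
    (fun x : spectrum T => cabs (chi (x : character T) (t^† ∘ t)))).
    exact: cabs_chi_continuous.
  exact: sqrt_continuous.
rewrite -local_norm_unit local_norm_cstar sqrtr_sqr ger0_norm ?local_norm_ge0 //.
by rewrite mul1r.
Qed.

(** Tameness is inherited from finitely many derived arrows [F i t]: the sum of their continuous
    functions serves for [t]. *)
Lemma tame_family (I : finType) κ τ (κ_ τ_ : I -> T)
    (F : forall i, arrow κ τ -> arrow (κ_ i) (τ_ i)) (K : I -> R) :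
  (forall i, tame_hom (κ_ i) (τ_ i)) ->
  (forall i, 0 <= K i) ->
  (forall t x, N x t <= \sum_i K i * N x (F i t)) ->
  (forall i t x, N x (F i t) <= K i * N x t) -> tame_hom κ τ.
Proof.
move=> tameI K0 lower upper.
pose Φ i := projT1 (cid (tameI i)); pose CP i := projT2 (cid (tameI i)).
pose C i := projT1 (cid (CP i)).
have C0 i : 0 < C i by have [] := projT2 (cid (CP i)).
have Φc i t : continuous (Φ i t) by have [_ /(_ t)[]] := projT2 (cid (CP i)).
have ΦP i t x : N x t <= C i * Φ i t x /\ Φ i t x <= C i * N x t.
  by have [_ /(_ t)[_ /(_ x)]] := projT2 (cid (CP i)).
have Φ0 i t x : 0 <= Φ i t x.
  by have [+ _] := ΦP i t x => /(le_trans (local_norm_ge0 _ _)); rewrite pmulr_rge0.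
have CK0 i : 0 <= C i * K i by rewrite mulr_ge0 // ltW.
(* The summand 1 keeps the constant positive even when the sum vanishes. *)
exists (fun t x => \sum_i Φ i (F i t) x), (1 + \sum_i C i * K i); split.
  by rewrite ltr_wpDr // sumr_ge0.
move=> t; split=> [|x].
  by apply: continuous_big => [|i _]; [exact: add_continuous|exact: Φc].
split.
  rewrite (le_trans (lower t x)) // mulr_sumr ler_sum // => i _.
  rewrite (@le_trans _ _ (C i * K i * Φ i (F i t) x)) //.
    rewrite mulrAC mulrC ler_wpM2r //.
    by have [] := ΦP i (F i t) x.
  by rewrite ler_wpM2r // (bigD1 i) //= ler_wpDl // lerDl sumr_ge0.
rewrite mulrDl mul1r ler_wpDl ?local_norm_ge0 // mulr_suml ler_sum // => i _.
have [_ /le_trans -> //] := ΦP i (F i t) x.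
by rewrite -mulrA ler_wpM2l // ltW.
Qed.

(** An arrow [t] is recovered as the sum of the [(t ∘ (S i)^†) ∘ S i]. *)
Lemma tame_dominated ρ' ρ : (forall n, tame (ρ ^⊗ n)) -> dominated ρ' ρ -> tame ρ'.
Proof.
move=> tameρ [m [n [S [_ _ S1]]]] τ.
apply: (@tame_family _ _ _ (fun i => ρ ^⊗ n i) (fun=> τ)
  (fun i t => t ∘ (S i)^†) (fun i => nrm (S i))) => [i|i|t x|i t x].
- exact: tameρ.
- exact: nrm_ge0.
- rewrite -[t in leLHS]compid S1 comp_sumr (le_trans (local_norm_sum _ _ _ _)) //.
  by apply: ler_sum => i _; rewrite compA local_norm_comp_le_r.
- by rewrite (le_trans (local_norm_comp_le_r _ _ _)) // nrm_star.
Qed.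

(** One side of a conjugate equation. No single pair [e], [w] has to solve it; below, a finite sum
    of such terms is the identity. *)
Definition zigzag ρ σ (e : arrow (ρ ⊙ σ) ι) (w : arrow ι (σ ⊙ ρ)) : arrow ρ ρ :=
  hcast (tob1r ρ) (tob1l ρ) ((e ⊗ idn ρ) ∘ hcast erefl (tobA ρ σ ρ) (idn ρ ⊗ w)).

Definition zigzag_sum ρ σ (X : arrow ρ ρ) : Prop :=
  exists (I : finType) (e : I -> arrow (ρ ⊙ σ) ι) (w : I -> arrow ι (σ ⊙ ρ)),
    X = \sum_i zigzag (e i) (w i).

Lemma zigzagZ ρ σ a (e : arrow (ρ ⊙ σ) ι) (w : arrow ι (σ ⊙ ρ)) :
  zigzag (a *: e) w = a *: zigzag e w.
Proof.
have [_ _ fZ _ _] := linearP_fun (@tens_linear_l _ _ (ρ ⊙ σ) ι _ _ (idn ρ)).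
have [_ _ hZ _ _] := linearP_fun (@hcast_linear _ _ _ _ _ _ (tob1r ρ) (tob1l ρ)).
by rewrite /zigzag fZ compZl hZ.
Qed.

Lemma zigzag_sum_subspace ρ σ : is_subspace [set X | @zigzag_sum ρ σ X].
Proof.
split=> [|a X Y [I [e [w ->]]] [J [e' [w' ->]]]].
  by exists void, (fun=> 0), (fun=> 0); rewrite big_pred0 // => -[].
exists (I + J)%type.
exists (fun k => match k with inl i => a *: e i | inr j => e' j end).
exists (fun k => match k with inl i => w i | inr j => w' j end).
rewrite big_sumType /= scaler_sumr; congr (_ + _).
by apply: eq_bigr => i _; rewrite zigzagZ.
Qed.

(** Bending ρ to the target by [w] and back by [e] turns [t] into [t ∘ (zigzag e w ⊗ 1)]; the bent
    arrow starts at κ alone. *)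
Lemma zigzag_transport ρ σ κ τ (e : arrow (ρ ⊙ σ) ι) (w : arrow ι (σ ⊙ ρ))
    (t : arrow (ρ ⊙ κ) τ) :
  hcast erefl (tob1l τ) ((e ⊗ idn τ) ∘ hcast erefl (tobA ρ σ τ)
    (idn ρ ⊗ ((idn σ ⊗ t) ∘ hcast (tob1l κ) (esym (tobA σ ρ κ)) (w ⊗ idn κ))))
  = t ∘ (zigzag e w ⊗ idn κ).
Proof.
apply: pack_inj; rewrite !(pack_hcast, pack_comp, pack_tens).
rewrite -/(pid τ) -/(pid ρ) -/(pid σ) -/(pid κ).
set E := pack e; set W := pack w; set S := pack t.
rewrite ptens_pidl /= ?tobA // ptens_pidr /= ?tobA // pcompA /= ?tobA ?tob1r //.
(* [e] and [t] act on disjoint factors, so the interchange law swaps them. *)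
have slide : pcomp (ptens E (pid τ)) (ptens (pid (ρ ⊙ σ)) S) =
    pcomp S (ptens E (pid (ρ ⊙ κ))).
  rewrite -[pid τ]/(pid (cod S)) -[pid (ρ ⊙ σ)]/(pid (dom E)) -ptens_slide ptens_slide'.
  by rewrite -[cod E]/ι ptens1l.
rewrite (ptensA (pid ρ) (pid σ)) -pid_tob slide.
by rewrite -pcompA ?pid_tob ?ptensA //= ?tobA ?tob1l ?tob1r.
Qed.

Lemma nrm_zigzag_pull ρ σ κ τ (w : arrow ι (σ ⊙ ρ)) (t : arrow (ρ ⊙ κ) τ) x :
  N x ((idn σ ⊗ t) ∘ hcast (tob1l κ) (esym (tobA σ ρ κ)) (w ⊗ idn κ)) <= nrm w * N x t.
Proof.
rewrite (le_trans (local_norm_comp_le_r _ _ _)) // ler_pM ?nrm_ge0 ?local_norm_ge0 //.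
  by rewrite nrm_hcast nrm_tens_idr.
exact: local_norm_tens_idl.
Qed.

Lemma nrm_zigzag_push ρ σ κ τ (e : arrow (ρ ⊙ σ) ι) (s : arrow κ (σ ⊙ τ)) x :
  N x (hcast erefl (tob1l τ) ((e ⊗ idn τ) ∘ hcast erefl (tobA ρ σ τ) (idn ρ ⊗ s)))
  <= nrm e * N x s.
Proof.
rewrite local_norm_hcast (le_trans (local_norm_comp_le_l _ _ _)) //.
rewrite ler_pM ?nrm_ge0 ?local_norm_ge0 ?nrm_tens_idr // local_norm_hcast.
exact: local_norm_tens_idl.
Qed.

(** The bent arrows [F i t] start at κ and determine [t]. Bending costs [nrm (w i)], unbending
    [nrm (e i)], and their sum serves as the constant for both. *)
Lemma tame_tensor ρ σ κ : zigzag_sum σ (idn ρ) -> tame κ -> tame (ρ ⊙ κ).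
Proof.
move=> [I [e [w idE]]] tameκ τ.
pose F i (t : arrow (ρ ⊙ κ) τ) : arrow κ (σ ⊙ τ) :=
  (idn σ ⊗ t) ∘ hcast (tob1l κ) (esym (tobA σ ρ κ)) (w i ⊗ idn κ).
apply: (@tame_family _ _ _ (fun=> κ) (fun=> σ ⊙ τ) F (fun i => nrm (e i) + nrm (w i)))
  => [i|i|t x|i t x].
- exact: tameκ.
- by rewrite addr_ge0 ?nrm_ge0.
- have tE : t = \sum_i hcast erefl (tob1l τ)
      ((e i ⊗ idn τ) ∘ hcast erefl (tobA ρ σ τ) (idn ρ ⊗ F i t)).
    rewrite -[LHS]compid -tens_id [in LHS]idE.
    rewrite (_ : (\sum_i _) ⊗ _ = \sum_i zigzag (e i) (w i) ⊗ idn κ).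
      by rewrite comp_sumr; apply: eq_bigr => i _; rewrite -zigzag_transport.
    have [f0 fD _ _ _] := linearP_fun (@tens_linear_l _ _ ρ ρ _ _ (idn κ)).
    exact: (big_morph (fun X => X ⊗ idn κ) fD f0).
  rewrite [in leLHS]tE (le_trans (local_norm_sum _ _ _ _)) // ler_sum // => i _.
  rewrite (le_trans (nrm_zigzag_push _ _ _)) // ler_wpM2r ?local_norm_ge0 //.
  by rewrite lerDl nrm_ge0.
- rewrite (le_trans (nrm_zigzag_pull _ _ _)) // ler_wpM2r ?local_norm_ge0 //.
  by rewrite lerDr nrm_ge0.
Qed.

Lemma tame_tpow ρ σ n : zigzag_sum σ (idn ρ) -> tame (ρ ^⊗ n).
Proof. by move=> ρZ; elim: n => [|n IH]; [exact: tame_unit|exact: tame_tensor ρZ IH]. Qed.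

End Tame.

(** * Conjugate equations from twisted special objects *)

Section SpecialObjects.
Context {R : realType} {T : symmetric_tensor_cstar_category R}.

Lemma lspan_min (V : completeNormedModType R[i]) (A B : set V) :
  is_subspace B -> A `<=` B -> lspan A `<=` B.
Proof. by move=> sB AB t; apply. Qed.

Lemma lspan_subspace (V : completeNormedModType R[i]) (A : set V) : is_subspace (lspan A).
Proof.
split=> [B [[B0 _] _]|a u v uA vA B [sB AB]]; first exact: B0.
by apply: sB.2; [exact: uA|exact: vA].
Qed.

Lemma sub_lspan (V : completeNormedModType R[i]) (A : set V) : A `<=` lspan A.
Proof. by move=> t At B [_]; exact. Qed.

Variables (ρ : T) (d : nat) (V : set (arrow ι (ρ ^⊗ d))).
Hypothesis special : twisted_special V.

Let inner := lspan [set f : arrow ι ι | exists v w, [/\ V v, V w & f = v^† ∘ w]].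
Let outer := [set u | exists v w, [/\ V v, V w & u = w ∘ v^†]].
Let P := antisymmetrizer ρ d.

Lemma outer_lact u : lspan outer u -> exists f, u = lact f P.
Proof. by rewrite (ts_span special) => -[f _ <-]; exists f. Qed.

(** For rank-one factors, [(w v^†)(w' v'^†)] is [v^† w'] acting on [w v'^†], which is some [f P] by
    [ts_span]. Span induction in each factor gives the general case. *)
Lemma outer_comp u u' : lspan outer u -> lspan outer u' ->
  exists2 k, inner k & u ∘ u' = lact k P.
Proof.
have [i0 iD] : is_subspace inner := lspan_subspace _.
move=> uO u'O; move: u uO.
pose B := [set u | exists2 k, inner k & u ∘ u' = lact k P].
suff : lspan outer `<=` B by move=> sub u /sub.
apply: lspan_min.
  split=> [|a u v [k ik uE] [l il vE]]; first by exists 0; rewrite ?comp0l ?lact0l.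
  exists (a *: k + l); first exact: iD.
  by rewrite compDl compZl uE vE lactDl lactZl.
move=> _ [v [w [Vv Vw ->]]]; rewrite {}/B /=; move: u' u'O.
pose B := [set u' | exists2 k, inner k & w ∘ v^† ∘ u' = lact k P].
suff : lspan outer `<=` B by move=> sub u /sub.
apply: lspan_min.
  split=> [|a u u' [k ik uE] [l il vE]]; first by exists 0; rewrite ?comp0r ?lact0l.
  exists (a *: k + l); first exact: iD.
  by rewrite compDr compZr uE vE lactDl lactZl.
move=> _ [v' [w' [Vv' Vw' ->]]].
have [f wv'] : exists f, w ∘ v'^† = lact f P.
  by apply: outer_lact; apply: sub_lspan; exists v', w.
have [_ Vfw'] := ts_bimodule special f Vw'.
(* Absorbing [f] into [w'], which stays in [V] by [ts_bimodule], keeps the coefficient in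
   [inner]. *)
exists (v^† ∘ lact f w'); first by apply: sub_lspan; exists v, (lact f w').
have scalar (g : arrow ι ι) (s : arrow (ρ ^⊗ d) ι) : g ∘ s = lact g s.
  by rewrite -[in LHS](idcomp s) compA -lact_unit -lact_compl idcomp.
rewrite -compA (compA (v^†)) scalar -lact_compr wv' lact_lact -lact_compr.
by rewrite lact_unit unit_compC.
Qed.

Lemma inner_id : inner (idn ι).
Proof.
have PO : lspan outer P.
  by rewrite (ts_span special); exists (idn ι) => //; rewrite lact1.
have [k ik] := outer_comp PO PO; rewrite antisymmetrizer_idempotent => Pk.
suff -> : idn ι = k by [].
apply/eqP; rewrite -subr_eq0; apply/eqP/(ts_faithful special).
by rewrite lactBl lact1 -Pk subrr.
Qed.

Lemma zigzag_inner v w (σ := ρ ^⊗ d.-1) : V v -> V w ->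
  zigzag_sum σ (lact (((-1) ^+ d.-1 * d%:R^-1) *: (v^† ∘ w)) (idn ρ)).
Proof.
move=> Vv Vw; rewrite -(ts_conjugate special Vv Vw) {}/σ.
move: (ts_dim special) v w {Vv Vw}; case: (d) => // n _ v w /=.
(* Once [d] is a successor, [ts_conjugate] is a single zigzag; only [w] has to be cast, its target
   being read with ρ as the last factor. *)
exists unit, (fun=> v^†), (fun=> hcast erefl (esym (tpowSr ρ n)) w).
rewrite big_const card_unit /= addr0; apply: pack_inj.
by rewrite /zigzag !(pack_hcast, pack_comp, pack_tens).
Qed.

(** Zigzag sums form a subspace, so [zigzag_inner] extends to all of [inner], in particular to the
    identity; the nonzero scalar [c] of [ts_conjugate] is then divided out. *)
Lemma special_zigzag_sum : zigzag_sum (ρ ^⊗ d.-1) (idn ρ).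
Proof.
pose c : R[i] := (-1) ^+ d.-1 * d%:R^-1.
have c0 : c != 0 by rewrite mulf_neq0 ?signr_eq0 ?invr_eq0 ?pnatr_eq0 -?lt0n ?(ts_dim special).
have [z0 zD] := zigzag_sum_subspace ρ (ρ ^⊗ d.-1).
have sub : inner `<=` [set f | zigzag_sum (ρ ^⊗ d.-1) (lact (c *: f) (idn ρ))].
  apply: lspan_min; last by move=> _ [v [w [Vv Vw ->]]]; exact: zigzag_inner.
  split=> [|a f g fZ gZ] /=; first by rewrite scaler0 lact0l.
  rewrite scalerDr scalerA (mulrC c) -scalerA lactDl lactZl; exact: zD.
have := sub _ inner_id; rewrite /= lactZl lact1 => /(zD c^-1 _ 0) /(_ z0).
by rewrite /= addr0 scalerA mulVf // scale1r.
Qed.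

End SpecialObjects.

(** * Continuity of the fibre norms *)

Section Continuity.
Context {R : realType} {T : symmetric_tensor_cstar_category R}.

(** A high power of [a / b] absorbs any constant, which is how the tameness constant disappears. *)
Lemma exp_eventually_lt (a b K : R) : 0 <= a -> a < b -> 0 < K ->
  exists k, K * a ^+ (2 ^ k.+1) < b ^+ (2 ^ k.+1).
Proof.
move=> a0 ab K0; have b0 : 0 < b by exact: le_lt_trans ab.
have q0 : 0 <= a / b by rewrite divr_ge0 // ltW.
have q1 : a / b < 1 by rewrite ltr_pdivrMr // mul1r.
have [n qn] := geometric_small q0 q1 (divr_gt0 ltr01 K0).
exists n; have nM : (n <= 2 ^ n.+1)%N.
  by rewrite ltnW // (ltn_trans (ltnSn _)) // ltn_expl.
have : (a / b) ^+ (2 ^ n.+1) < 1 / K.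
  by apply: le_lt_trans qn; rewrite ler_wiXn2l // ltW.
rewrite expr_div_n ltr_pdivlMr // mulrAC ltr_pdivrMr ?exprn_gt0 // mul1r.
by rewrite mulrC.
Qed.

Lemma tame_continuous (ρ σ : T) (t : arrow ρ σ) : tame ρ ->
  continuous (fun x : spectrum T => local_norm (x : character T) t).
Proof.
move=> /(_ ρ) [Φ [C [C0 ΦP]]].
(* [b k] is the power [2^k] of [t^† ∘ t], an endomorphism of ρ whose local norm is exactly [N x] to
   the power [2^(k+1)]. *)
pose b k := iter k (fun s : arrow ρ ρ => s ∘ s) (t^† ∘ t).
have bS k : (b k)^† = b k.
  elim: k => [|k IH] /=; first by rewrite star_compose starK.
  by rewrite star_compose IH.
pose N (x : spectrum T) := local_norm (x : character T) t.
have N0 x : 0 <= N x by exact: local_norm_ge0.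
have bN k (x : spectrum T) : local_norm (x : character T) (b k) = N x ^+ (2 ^ k.+1).
  elim: k => [|k IH]; first by rewrite /= local_norm_cstar.
  by rewrite /= -{1}bS local_norm_cstar IH -exprM -expnSr.
have Φc k := (ΦP (b k)).1.
have lower k x : N x ^+ (2 ^ k.+1) <= C * Φ (b k) x.
  by have [_ /(_ x)[+ _]] := ΦP (b k); rewrite bN.
have upper k x : Φ (b k) x <= C * N x ^+ (2 ^ k.+1).
  by have [_ /(_ x)[_ +]] := ΦP (b k); rewrite bN.
have M0 k : (0 < 2 ^ k.+1)%N by rewrite expn_gt0.
have mono k (u v : R) : 0 <= v -> u ^+ (2 ^ k.+1) < v ^+ (2 ^ k.+1) -> u < v.
  move=> v0; rewrite !ltNge; apply: contra => vu; rewrite lerXn2r ?nnegrE //.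
  exact: le_trans vu.
move=> x; have ? : Filter (nbhs x) by exact: nbhs_filter.
apply/cvgrPdist_lt => e e0.
(* Choose [k] at the point [x] so that the gap [e] outweighs [C * C]; continuity of [Φ (b k)]
   carries a strict bound to nearby [y], and [lower] turns it back into one on [N y]. *)
have up : \forall y \near x, N y < N x + e.
  have [k kE] := @exp_eventually_lt (N x) (N x + e) (C * C) (N0 x)
    (ltac:(by rewrite ltrDl)) (mulr_gt0 C0 C0).
  have /(cvgr_lt _ (Φc k x)) : Φ (b k) x < (N x + e) ^+ (2 ^ k.+1) / C.
    rewrite ltr_pdivlMr // mulrC (le_lt_trans _ kE) // -mulrA ler_wpM2l ?upper //.
    exact: ltW.
  apply: filterS => y; rewrite ltr_pdivlMr // mulrC => Φy.
  apply: (mono k); first by rewrite addr_ge0 // ltW.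
  by rewrite (le_lt_trans (lower k y)).
have down : \forall y \near x, N x - e < N y.
  (* Powers compare only nonnegative numbers; a negative lower bound is trivial. *)
  have [neg|pos] := ltP (N x - e) 0.
    by apply: (@nearW _ (nbhs x)) => y; exact: lt_le_trans neg _.
  have [k kE] := @exp_eventually_lt (N x - e) (N x) (C * C) pos
    (ltac:(by rewrite gtrBl)) (mulr_gt0 C0 C0).
  have /(cvgr_gt _ (Φc k x)) : C * (N x - e) ^+ (2 ^ k.+1) < Φ (b k) x.
    by rewrite -(ltr_pM2l C0) mulrA (lt_le_trans kE).
  apply: filterS => y Φy; apply: (mono k) => //.
  by rewrite -(ltr_pM2l C0) (lt_le_trans Φy).
apply: (@filterS2 _ (nbhs x) _ _ _ _ _ up down) => y yu yd.
by rewrite ltr_distlC; apply/andP; split.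
Qed.

End Continuity.

Theorem theorem3p9 (R : realType) (T : symmetric_tensor_cstar_category R) :
  [set f : arrow (ι : T) ι | central f] = [set: arrow (ι : T) ι] /\
  (T_specially_directed T -> continuous_bundle T).
Proof.
split; first by apply/seteqP; split=> // f _; exact: unit_central.
move=> directed ρ σ t.
have [κ [d [V [special dom_ρ]]]] := directed ρ.
have tame_ρ : tame ρ.
  by apply: tame_dominated dom_ρ => n; apply: tame_tpow (special_zigzag_sum special).
rewrite (_ : (fun x => _) = fun x => local_norm (x : character T) t).
  exact: tame_continuous.
by apply/funext => x; exact: fibre_normE.
Qed.
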